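(* Let $f$ be a non-constant entire function with an essential singularity at infinity. For any $Y\subset\mathbb{C}$, there exists a countable set $X\subset\mathbb{C}$ with Nagata dimension zero so that $f(X)$ is dense in $Y$ (and hence $\dim_N f(X)=\dim_N Y$).
   Context: Subsets of $\mathbb{C}$ carry the Euclidean metric. Nagata dimension: let $(X,d)$ be a metric space. A family $\mathcal{B}$ of subsets of $X$ is $s$-bounded, for a constant $s\ge 0$, if every member has diameter at most $s$. For $s>0$, the $s$-multiplicity of $\mathcal{B}$ is the infimum of all integers $n\ge 0$ such that every subset of $X$ of diameter $\le s$ meets at most $n$ members of $\mathcal{B}$. The Nagata dimension $\dim_N X$ is the infimum of all integers $n$ with the following property: there exists a constant $c>0$ such that for all $s>0$, $X$ admits a $cs$-bounded covering with $s$-multiplicity at most $n+1$.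
   Formalization: ''f(X) dense in Y'' is proved as Y ⊂ closure of f(X); f(X) ⊂ Y only if Y is nonempty and Y∩f(ℂ) is dense in Y (it fails for f=exp, Y={0}); dim_N f(X)=dim_N Y is claimed for nonempty Y only, as dim_N ∅ = −1. *)

(* Defs.v *)
From Stdlib Require Import Reals ZArith List Ensembles.
From Stdlib Require Image.
From Coquelicot Require Import Coquelicot.

Open Scope R_scope.

Notation image f X := (Image.Im C C X f).

Definition dist (z w : C) : R := Cmod (z - w)%C.

Definition closure (A : Ensemble C) : Ensemble C :=
  fun z => forall eps : R, 0 < eps -> exists w, A w /\ dist z w < eps.

(* [A] need not be contained in [B]. *)
Definition dense_in (A B : Ensemble C) : Prop := Included C B (closure A).

(* Finite (possibly empty) or countably infinite. *)
Definition countable (A : Ensemble C) : Prop :=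
  exists code : C -> nat,
    forall z w, A z -> A w -> code z = code w -> z = w.

(** * Nagata dimension of a subset of C *)

(* [m_infty] for the empty set. *)
Definition diam (A : Ensemble C) : Rbar :=
  Lub_Rbar (fun r => exists z w, A z /\ A w /\ r = dist z w).

Definition family := Ensemble (Ensemble C).

Definition bounded_family (s : R) (B : family) : Prop :=
  forall b, B b -> Rbar_le (diam b) s.

Definition covering (X : Ensemble C) (B : family) : Prop :=
  (forall b, B b -> Included C b X) /\
  (forall z, X z -> exists b, B b /\ b z).

Definition meets (A b : Ensemble C) : Prop := Inhabited C (Intersection C A b).

Definition meets_at_most (A : Ensemble C) (B : family) (n : nat) : Prop :=
  forall l : list (Ensemble C), NoDup l ->
    (forall b, List.In b l -> B b /\ meets A b) -> (length l <= n)%nat.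

(* [p_infty] when no [n] qualifies; likewise for [nagata_dim]. *)
Definition multiplicity (X : Ensemble C) (s : R) (B : family) : Rbar :=
  Glb_Rbar (fun x => exists n : nat, x = INR n /\
    forall A, Included C A X -> Rbar_le (diam A) s -> meets_at_most A B n).

(* [n] ranges over all integers, so the empty set has dimension -1. *)
Definition nagata_dim (X : Ensemble C) : Rbar :=
  Glb_Rbar (fun x => exists n : Z, x = IZR n /\
    exists c : R, 0 < c /\ forall s : R, 0 < s ->
      exists B : family, covering X B /\ bounded_family (c * s) B /\
        Rbar_le (multiplicity X s B) (IZR (n + 1))).

(** * Entire functions and isolated singularities *)

(* [ex_derive] is taken over the field C, i.e. complex differentiability. *)
Definition holomorphic_on (D : Ensemble C) (g : C -> C) : Prop :=
  forall z, D z -> @ex_derive C_AbsRing C_NormedModule g z.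

Definition entire (f : C -> C) : Prop := holomorphic_on (Full_set C) f.

Definition disc (a : C) (r : R) : Ensemble C := fun z => dist z a < r.

Definition punctured_disc (a : C) (r : R) : Ensemble C :=
  fun z => 0 < dist z a < r.

Definition isolated_singularity (g : C -> C) (a : C) : Prop :=
  exists r, 0 < r /\ holomorphic_on (punctured_disc a r) g.

Definition removable_singularity (g : C -> C) (a : C) : Prop :=
  exists r, 0 < r /\ exists h : C -> C,
    holomorphic_on (disc a r) h /\
    forall z, punctured_disc a r z -> h z = g z.

Definition pole (g : C -> C) (a : C) : Prop :=
  filterlim (fun z => Cmod (g z)) (locally' a) (Rbar_locally p_infty).

Definition essential_singularity (g : C -> C) (a : C) : Prop :=
  isolated_singularity g a /\ ~ removable_singularity g a /\ ~ pole g a.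

Definition essential_singularity_at_infinity (f : C -> C) : Prop :=
  essential_singularity (fun z => f (/ z)%C) (RtoC 0).

(* Main.v *)
(** Only Picard's theorem is needed from function theory, in the form: at most one
    value has a bounded fibre.  It is obtained from Schottky's theorem and
    Liouville's theorem: since infinity is not a pole, [f] is moderate at points of
    arbitrarily large modulus; if two values had bounded fibres, Schottky's bound
    would propagate to annuli around the corresponding circles, and [f] would be
    constant.  Schottky's theorem itself rests on the Borel-Caratheodory inequality,
    which follows from the maximum principle for real parts, hence from Goursat's
    theorem.

    Given Picard, choose a countable dense subset of [Y] consisting of attained
    values and pick preimages whose moduli at least double at each step: such a
    lacunary set has Nagata dimension zero.  If [Y] has an isolated omitted value
    [e], values converging geometrically to [e] are used instead; adding them does
    not change the Nagata dimension, and neither does passing to a set with the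
    same closure. *)

From Stdlib Require Import Reals Lra Lia Ensembles List Classical ClassicalEpsilon ZArith Cantor.
From Coquelicot Require Import Coquelicot.
(* Required last: [dist] must denote the Euclidean distance of [Defs], not [Rlimit.dist]. *)
Require Import Defs.

(** * Complex differentiability *)

(** Differentiability is given pointwise and nothing is known about the continuity of the
    derivative, so Green's theorem cannot replace Goursat's bisection. Power series, higher
    derivatives and Cauchy's formula are avoided altogether: the derivative at the centre of a disc
    is controlled by the maximum principle for real parts, applied to an explicit auxiliary
    function, and this one bound yields both a Cauchy estimate and Liouville's theorem. Schottky's
    theorem is reached without Bloch's theorem: two successive inverse hyperbolic cosines produce a
    function that omits a point within a fixed distance of every complex number, and the derivative
    of such a function is bounded directly. On the metric side, nothing relates the geometry of
    preimages to that of [Y]; unbounded fibres give the freedom to ignore the shape of [Y] and to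
    make [X] as sparse as desired. *)

Definition ccont (f : C -> C) (z : C) : Prop :=
  forall eps, 0 < eps ->
    exists d, 0 < d /\ forall w, Cmod (w - z) < d -> Cmod (f w - f z) < eps.

(** Caratheodory's form of the derivative: the slope [phi] extends continuously to [z]. The product,
    inverse and chain rules become algebra on slopes, with no error terms to estimate. *)
Definition cderiv (f : C -> C) (z l : C) : Prop :=
  exists phi, ccont phi z /\ phi z = l /\
    exists d, 0 < d /\ forall w, Cmod (w - z) < d -> f w = (f z + phi w * (w - z))%C.

Lemma Cmod_sub_diag (z : C) : Cmod (z - z) = 0.
Proof. rewrite <- Cmod_0. f_equal. ring. Qed.

Lemma Cmod_sub_sym (z w : C) : Cmod (z - w) = Cmod (w - z).
Proof. rewrite <- Cmod_opp. f_equal. ring. Qed.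

Lemma Cmod_sub_triangle (a b c : C) : Cmod (a - c) <= Cmod (a - b) + Cmod (b - c).
Proof. replace (a - c)%C with ((a - b) + (b - c))%C by ring. apply Cmod_triangle. Qed.

Lemma Cmod_le_sub (a b : C) : Cmod a <= Cmod b + Cmod (a - b).
Proof. replace a with (b + (a - b))%C at 1 by ring. apply Cmod_triangle. Qed.

Lemma im_le_Cmod (z : C) : Rabs (Im z) <= Cmod z.
Proof. eapply Rle_trans; [apply Rmax_r | apply Rmax_Cmod]. Qed.

Lemma Cmod_le_Re_Im (z : C) : Cmod z <= Rabs (Re z) + Rabs (Im z).
Proof.
  replace z with ((Re z) + Ci * (Im z))%C at 1.
  - eapply Rle_trans; [apply Cmod_triangle|].
    rewrite Cmod_mult, Cmod_Ci, !Cmod_R. lra.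
  - apply injective_projections; simpl; unfold Re, Im; ring.
Qed.

Lemma Cmod_pair_fst (x x' y : R) : Cmod ((x, y) - (x', y)) = Rabs (x - x').
Proof. rewrite <- Cmod_R. f_equal. apply injective_projections; simpl; ring. Qed.

Lemma Cmod_pair_snd (x y y' : R) : Cmod ((x, y) - (x, y')) = Rabs (y - y').
Proof.
  replace ((x, y) - (x, y'))%C with (Ci * RtoC (y - y'))%C.
  - rewrite Cmod_mult, Cmod_Ci, Cmod_R. ring.
  - apply injective_projections; simpl; ring.
Qed.

Lemma ccont_ext_loc (f g : C -> C) (z : C) (d : R) :
  0 < d -> (forall w, Cmod (w - z) < d -> f w = g w) -> ccont f z -> ccont g z.
Proof.
  intros Hd E Hf eps He. destruct (Hf eps He) as [d' [Hd' H]].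
  exists (Rmin d d'). split; [now apply Rmin_pos|]. intros w Hw.
  assert (Cmod (w - z) < d) by (eapply Rlt_le_trans; [exact Hw|apply Rmin_l]).
  assert (Cmod (w - z) < d') by (eapply Rlt_le_trans; [exact Hw|apply Rmin_r]).
  rewrite <- !E; auto. rewrite Cmod_sub_diag; lra.
Qed.

Lemma ccont_const (c z : C) : ccont (fun _ => c) z.
Proof. intros eps He. exists 1. split; [lra|]. intros. rewrite Cmod_sub_diag. lra. Qed.

Lemma ccont_id (z : C) : ccont (fun w => w) z.
Proof. intros eps He. exists eps. auto. Qed.

Lemma ccont_plus (f g : C -> C) (z : C) :
  ccont f z -> ccont g z -> ccont (fun w => f w + g w)%C z.
Proof.
  intros Hf Hg eps He.
  destruct (Hf (eps/2)) as [d1 [H1 K1]]; [lra|].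
  destruct (Hg (eps/2)) as [d2 [H2 K2]]; [lra|].
  exists (Rmin d1 d2). split; [now apply Rmin_pos|]. intros w Hw.
  assert (A := K1 w (Rlt_le_trans _ _ _ Hw (Rmin_l _ _))).
  assert (B := K2 w (Rlt_le_trans _ _ _ Hw (Rmin_r _ _))).
  replace (f w + g w - (f z + g z))%C with ((f w - f z) + (g w - g z))%C by ring.
  eapply Rle_lt_trans; [apply Cmod_triangle|]. lra.
Qed.

Lemma ccont_mult (f g : C -> C) (z : C) :
  ccont f z -> ccont g z -> ccont (fun w => f w * g w)%C z.
Proof.
  intros Hf Hg eps He.
  set (A := Cmod (f z) + 1). set (B := Cmod (g z) + 1).
  assert (HA : 0 < A) by (unfold A; generalize (Cmod_ge_0 (f z)); lra).
  assert (HB : 0 < B) by (unfold B; generalize (Cmod_ge_0 (g z)); lra).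
  destruct (Hf (Rmin 1 (eps / (2 * B)))) as [d1 [H1 K1]].
  { apply Rmin_pos; [lra|]. apply Rdiv_lt_0_compat; lra. }
  destruct (Hg (eps/(2 * A))) as [d2 [H2 K2]].
  { apply Rdiv_lt_0_compat; lra. }
  exists (Rmin d1 d2). split; [now apply Rmin_pos|]. intros w Hw.
  assert (U := K1 w (Rlt_le_trans _ _ _ Hw (Rmin_l _ _))).
  assert (V := K2 w (Rlt_le_trans _ _ _ Hw (Rmin_r _ _))).
  assert (U1 := Rlt_le_trans _ _ _ U (Rmin_l _ _)).
  assert (U2 := Rlt_le_trans _ _ _ U (Rmin_r _ _)).
  replace (f w * g w - f z * g z)%C with (f w * (g w - g z) + (f w - f z) * g z)%C by ring.
  eapply Rle_lt_trans; [apply Cmod_triangle|]. rewrite !Cmod_mult.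
  assert (W := Cmod_le_sub (f w) (f z)).
  assert (Cmod (f w) * Cmod (g w - g z) <= A * Cmod (g w - g z)).
  { apply Rmult_le_compat_r; [apply Cmod_ge_0|]. unfold A; lra. }
  assert (A * Cmod (g w - g z) < eps / 2).
  { replace (eps/2) with (A * (eps/(2*A))) by (field; lra).
    now apply Rmult_lt_compat_l. }
  assert (Cmod (f w - f z) * Cmod (g z) <= Cmod (f w - f z) * B).
  { apply Rmult_le_compat_l; [apply Cmod_ge_0|]. unfold B; lra. }
  assert (Cmod (f w - f z) * B < eps / 2).
  { replace (eps/2) with (eps/(2*B) * B) by (field; lra).
    now apply Rmult_lt_compat_r. }
  lra.
Qed.

Lemma ccont_opp (f : C -> C) (z : C) : ccont f z -> ccont (fun w => - f w)%C z.
Proof.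
  intros H eps He. destruct (H eps He) as [d [Hd K]]. exists d. split; auto.
  intros w Hw. replace (- f w - - f z)%C with (- (f w - f z))%C by ring.
  rewrite Cmod_opp. auto.
Qed.

Lemma ccont_minus (f g : C -> C) (z : C) :
  ccont f z -> ccont g z -> ccont (fun w => f w - g w)%C z.
Proof. intros. unfold Cminus. apply ccont_plus; auto. now apply ccont_opp. Qed.

Lemma ccont_nonzero (f : C -> C) (z : C) :
  ccont f z -> f z <> 0 ->
  exists d, 0 < d /\ forall w, Cmod (w - z) < d -> Cmod (f z) / 2 < Cmod (f w).
Proof.
  intros H N. assert (P := proj1 (Cmod_gt_0 _) N).
  destruct (H (Cmod (f z) / 2)) as [d [Hd K]]; [lra|].
  exists d. split; auto. intros w Hw. specialize (K w Hw).
  rewrite Cmod_sub_sym in K. generalize (Cmod_le_sub (f z) (f w)). lra.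
Qed.

Lemma ccont_inv (f : C -> C) (z : C) :
  ccont f z -> f z <> 0 -> ccont (fun w => / f w)%C z.
Proof.
  intros H N eps He. assert (P := proj1 (Cmod_gt_0 _) N).
  destruct (ccont_nonzero f z H N) as [d1 [H1 K1]].
  set (m := Cmod (f z)) in *.
  destruct (H (eps * (m * m / 2))) as [d2 [H2 K2]].
  { apply Rmult_lt_0_compat; auto. nra. }
  exists (Rmin d1 d2). split; [now apply Rmin_pos|]. intros w Hw.
  assert (A := K1 w (Rlt_le_trans _ _ _ Hw (Rmin_l _ _))).
  assert (B := K2 w (Rlt_le_trans _ _ _ Hw (Rmin_r _ _))).
  assert (Nw : f w <> 0) by (apply Cmod_gt_0; lra).
  replace (/ f w - / f z)%C with (- ((f w - f z) / (f w * f z)))%C by (field; auto).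
  rewrite Cmod_opp, Cmod_div, Cmod_mult; [|now apply Cmult_neq_0].
  fold m. apply Rlt_div_l; [nra|].
  eapply Rlt_le_trans; [exact B|]. apply Rmult_le_compat_l; [lra|]. nra.
Qed.

Lemma ccont_comp (f g : C -> C) (z : C) :
  ccont g z -> ccont f (g z) -> ccont (fun w => f (g w)) z.
Proof.
  intros Hg Hf eps He. destruct (Hf eps He) as [d [Hd K]].
  destruct (Hg d Hd) as [d' [Hd' K']]. exists d'. auto.
Qed.

Lemma cderiv_ccont (f : C -> C) (z l : C) : cderiv f z l -> ccont f z.
Proof.
  intros (phi & Hc & _ & d & Hd & E).
  apply (ccont_ext_loc (fun w => f z + phi w * (w - z))%C f z d Hd).
  - intros w Hw. symmetry. auto.
  - apply ccont_plus; [apply ccont_const|]. apply ccont_mult; auto.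
    apply ccont_minus; [apply ccont_id|apply ccont_const].
Qed.

Lemma cderiv_eps (f : C -> C) (z l : C) :
  cderiv f z l -> forall eps, 0 < eps -> exists d, 0 < d /\
    forall w, Cmod (w - z) < d -> Cmod (f w - f z - l * (w - z)) <= eps * Cmod (w - z).
Proof.
  intros (phi & Hc & <- & d & Hd & E) eps He. destruct (Hc eps He) as [d' [Hd' K]].
  exists (Rmin d d'). split; [now apply Rmin_pos|]. intros w Hw.
  assert (A := E w (Rlt_le_trans _ _ _ Hw (Rmin_l _ _))).
  assert (B := K w (Rlt_le_trans _ _ _ Hw (Rmin_r _ _))).
  rewrite A. replace (f z + phi w * (w - z) - f z - phi z * (w - z))%C
    with ((phi w - phi z) * (w - z))%C by ring.
  rewrite Cmod_mult. apply Rmult_le_compat_r; [apply Cmod_ge_0|lra].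
Qed.

Lemma eps_cderiv (f : C -> C) (z l : C) :
  (forall eps, 0 < eps -> exists d, 0 < d /\
    forall w, Cmod (w - z) < d -> Cmod (f w - f z - l * (w - z)) <= eps * Cmod (w - z)) ->
  cderiv f z l.
Proof.
  intros H.
  exists (fun w => if Ceq_dec w z then l else (f w - f z) / (w - z))%C.
  split; [|split].
  - intros eps He. destruct (H (eps/2)) as [d [Hd K]]; [lra|].
    exists d. split; auto. intros w Hw. destruct (Ceq_dec z z) as [_|]; [|tauto].
    destruct (Ceq_dec w z) as [->|N]; [rewrite Cmod_sub_diag; lra|].
    assert (N' := Cminus_eq_contra _ _ N).
    assert (P := proj1 (Cmod_gt_0 _) N').
    replace ((f w - f z) / (w - z) - l)%C with ((f w - f z - l * (w - z)) / (w - z))%C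
      by (field; auto).
    rewrite Cmod_div by auto. apply Rlt_div_l; auto.
    eapply Rle_lt_trans; [now apply K|]. nra.
  - destruct (Ceq_dec z z); tauto.
  - exists 1. split; [lra|]. intros w _. destruct (Ceq_dec w z) as [->|N]; [ring|].
    field. now apply Cminus_eq_contra.
Qed.

Lemma ex_derive_cderiv (f : C -> C) (z : C) :
  @ex_derive C_AbsRing C_NormedModule f z -> exists l, cderiv f z l.
Proof.
  intros [l Hl]. exists l. apply eps_cderiv. intros eps He.
  (* The differential is required at every limit of the filter [locally z]; the point [z] is one
     trivially. *)
  destruct Hl as [_ Hl]. specialize (Hl z (fun P HP => HP) (mkposreal eps He)).
  destruct Hl as [d Hd]. exists d. split; [apply cond_pos|]. intros w Hw.
  specialize (Hd w Hw). simpl in Hd.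
  replace (f w - f z - l * (w - z))%C with
    (minus (minus (f w) (f z)) (scal (minus w z : C) (l : C_NormedModule))).
  - exact Hd.
  - unfold minus, scal, plus, opp; simpl. unfold mult; simpl. ring.
Qed.

Lemma cderiv_ext_loc (f g : C -> C) (z l : C) (d : R) :
  0 < d -> (forall w, Cmod (w - z) < d -> f w = g w) -> cderiv f z l -> cderiv g z l.
Proof.
  intros Hd E (phi & Hc & Hl & d' & Hd' & K).
  exists phi. repeat split; auto. exists (Rmin d d'). split; [now apply Rmin_pos|].
  intros w Hw.
  rewrite <- !E; auto.
  - apply K. eapply Rlt_le_trans; [exact Hw|apply Rmin_r].
  - rewrite Cmod_sub_diag; lra.
  - eapply Rlt_le_trans; [exact Hw|apply Rmin_l].
Qed.

Lemma cderiv_const (c z : C) : cderiv (fun _ => c) z 0.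
Proof.
  exists (fun _ => RtoC 0). split; [apply ccont_const|split; [auto|]].
  exists 1. split; [lra|]. intros; ring.
Qed.

Lemma cderiv_id (z : C) : cderiv (fun w => w) z 1.
Proof.
  exists (fun _ => RtoC 1). split; [apply ccont_const|split; [auto|]].
  exists 1. split; [lra|]. intros; ring.
Qed.

Lemma cderiv_plus (f g : C -> C) (z k l : C) :
  cderiv f z k -> cderiv g z l -> cderiv (fun w => f w + g w)%C z (k + l).
Proof.
  intros (p & Hp & Ep & d & Hd & K) (p' & Hp' & Ep' & d' & Hd' & K').
  exists (fun w => p w + p' w)%C. split; [now apply ccont_plus|].
  split; [now rewrite Ep, Ep'|].
  exists (Rmin d d'). split; [now apply Rmin_pos|]. intros w Hw.
  rewrite (K w (Rlt_le_trans _ _ _ Hw (Rmin_l _ _))).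
  rewrite (K' w (Rlt_le_trans _ _ _ Hw (Rmin_r _ _))). ring.
Qed.

Lemma cderiv_mult (f g : C -> C) (z k l : C) :
  cderiv f z k -> cderiv g z l -> cderiv (fun w => f w * g w)%C z (k * g z + f z * l).
Proof.
  intros Hf Hg. assert (Cf := cderiv_ccont _ _ _ Hf). revert Hf Hg.
  intros (p & Hp & Ep & d & Hd & K) (p' & Hp' & Ep' & d' & Hd' & K').
  exists (fun w => p w * g z + f w * p' w)%C. split; [|split].
  - apply ccont_plus; apply ccont_mult; auto. apply ccont_const.
  - now rewrite Ep, Ep'.
  - exists (Rmin d d'). split; [now apply Rmin_pos|]. intros w Hw.
    rewrite (K' w (Rlt_le_trans _ _ _ Hw (Rmin_r _ _))).
    rewrite (K w (Rlt_le_trans _ _ _ Hw (Rmin_l _ _))). ring.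
Qed.

Lemma cderiv_scal (c : C) (f : C -> C) (z k : C) :
  cderiv f z k -> cderiv (fun w => c * f w)%C z (c * k).
Proof.
  intros H. replace (c * k)%C with (0 * f z + c * k)%C by ring.
  apply (cderiv_mult (fun _ => c)); auto. apply cderiv_const.
Qed.

Lemma cderiv_minus (f g : C -> C) (z k l : C) :
  cderiv f z k -> cderiv g z l -> cderiv (fun w => f w - g w)%C z (k - l).
Proof.
  intros Hf Hg. replace (k - l)%C with (k + - (1) * l)%C by ring.
  apply (cderiv_ext_loc (fun w => f w + - (1) * g w)%C _ z _ 1); [lra| |].
  - intros; ring.
  - apply cderiv_plus; auto. now apply cderiv_scal.
Qed.

Lemma cderiv_inv (f : C -> C) (z k : C) :
  cderiv f z k -> f z <> 0 -> cderiv (fun w => / f w)%C z (- k / (f z * f z)).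
Proof.
  intros Hf N. assert (Cf := cderiv_ccont _ _ _ Hf).
  destruct (ccont_nonzero f z Cf N) as [d1 [H1 K1]]. revert Hf.
  intros (p & Hp & Ep & d & Hd & K).
  exists (fun w => - p w * / (f w * f z))%C. split; [|split].
  - apply ccont_mult; [now apply ccont_opp|]. apply ccont_inv.
    + apply ccont_mult; auto. apply ccont_const.
    + now apply Cmult_neq_0.
  - now rewrite Ep.
  - exists (Rmin d d1). split; [now apply Rmin_pos|]. intros w Hw.
    assert (A := K w (Rlt_le_trans _ _ _ Hw (Rmin_l _ _))).
    assert (B := K1 w (Rlt_le_trans _ _ _ Hw (Rmin_r _ _))).
    assert (Nw : f w <> 0) by (apply Cmod_gt_0; generalize (Cmod_ge_0 (f z)); lra).
    replace (- p w * / (f w * f z) * (w - z))%C with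
      (- (p w * (w - z)) * / (f w * f z))%C by ring.
    replace (p w * (w - z))%C with (f w - f z)%C by (rewrite A; ring).
    field; auto.
Qed.

Lemma cderiv_comp (f g : C -> C) (z k l : C) :
  cderiv g z l -> cderiv f (g z) k -> cderiv (fun w => f (g w)) z (k * l).
Proof.
  intros Hg Hf. assert (Cg := cderiv_ccont _ _ _ Hg). revert Hf Hg.
  intros (p & Hp & Ep & d & Hd & K) (p' & Hp' & Ep' & d' & Hd' & K').
  destruct (Cg d Hd) as [d2 [Hd2 K2]].
  exists (fun w => p (g w) * p' w)%C. split; [|split].
  - apply ccont_mult; auto. now apply ccont_comp.
  - now rewrite Ep, Ep'.
  - exists (Rmin d' d2). split; [now apply Rmin_pos|]. intros w Hw.
    rewrite (K (g w)) by (apply K2; eapply Rlt_le_trans; [exact Hw|apply Rmin_r]).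
    rewrite (K' w (Rlt_le_trans _ _ _ Hw (Rmin_l _ _))) at 2. ring.
Qed.

Lemma cderiv_translate (f : C -> C) (p z l : C) :
  cderiv f (p + z) l -> cderiv (fun w => f (p + w)%C) z l.
Proof.
  intros H. replace l with (l * (0 + 1))%C by ring.
  apply (cderiv_comp f (fun w => p + w)%C); auto.
  apply cderiv_plus; [apply cderiv_const|apply cderiv_id].
Qed.

(* [c] rotates the increment to the positive real axis, reducing to the real MVT. *)
Lemma cderiv_mean_value (g dg : C -> C) (p z : C) (B : R) :
  (forall s, 0 <= s <= 1 -> cderiv g (p + s * (z - p)) (dg (p + s * (z - p)))%C) ->
  (forall s, 0 <= s <= 1 -> Cmod (dg (p + s * (z - p))%C) <= B) ->
  Cmod (g z - g p) <= B * Cmod (z - p).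
Proof.
  intros Hd HB.
  destruct (Ceq_dec (g z - g p) 0) as [E|N].
  { rewrite E, Cmod_0. apply Rmult_le_pos; [|apply Cmod_ge_0].
    eapply Rle_trans; [apply Cmod_ge_0|]. apply (HB 0). lra. }
  set (c := (Cconj (g z - g p) / Cmod (g z - g p))%C).
  assert (P := proj1 (Cmod_gt_0 _) N).
  assert (NP : RtoC (Cmod (g z - g p)) <> 0) by (intro Q; apply RtoC_inj in Q; lra).
  assert (Hc : Cmod c = 1).
  { unfold c. rewrite Cmod_div, Cmod_conj, Cmod_R, Rabs_pos_eq; auto.
    - field; lra.
    - lra. }
  assert (Ec : (c * (g z - g p))%C = Cmod (g z - g p)).
  { unfold c. replace (Cconj (g z - g p) / Cmod (g z - g p) * (g z - g p))%C
     with (((g z - g p) * Cconj (g z - g p)) / Cmod (g z - g p))%C by (field; auto).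
    rewrite <- Cmod2_conj, RtoC_pow. field; auto. }
  set (th := fun s : R => Re (c * g (p + s * (z - p))%C)).
  set (dth := fun s : R => Re (c * (dg (p + s * (z - p))%C * (z - p)))).
  assert (D : forall s, 0 <= s <= 1 -> is_derive th s (dth s)).
  { intros s Hs. apply is_derive_Reals. intros eps He.
    set (q := (p + s * (z - p))%C).
    assert (HE : 0 < eps / (2 * (1 + Cmod (z - p)))).
    { apply Rdiv_lt_0_compat; auto. generalize (Cmod_ge_0 (z - p)). lra. }
    destruct (cderiv_eps _ _ _ (Hd s Hs) _ HE) as [d [Hdp K]].
    assert (Hdd : 0 < d / (1 + Cmod (z - p))).
    { apply Rdiv_lt_0_compat; auto. generalize (Cmod_ge_0 (z - p)). lra. }
    exists (mkposreal _ Hdd). intros h Nh Hh. simpl in Hh.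
    assert (Z := Cmod_ge_0 (z - p)).
    fold q in K. unfold th, dth. fold q.
    set (q' := (p + RtoC (s + h) * (z - p))%C).
    assert (Eq : (q' - q)%C = (h * (z - p))%C) by (unfold q', q; rewrite RtoC_plus; ring).
    assert (Hq : Cmod (q' - q) = Rabs h * Cmod (z - p)).
    { rewrite Eq, Cmod_mult, Cmod_R. auto. }
    assert (Hq' : Cmod (q' - q) < d).
    { rewrite Hq. apply Rlt_div_r in Hh; [|lra]. generalize (Rabs_pos h). nra. }
    specialize (K q' Hq'). rewrite Hq in K.
    replace ((Re (c * g q') - Re (c * g q)) / h - Re (c * (dg q * (z - p))))
      with (Re (c * (g q' - g q - dg q * (q' - q))) / h).
    2:{ rewrite Eq.
        replace (Re (c * (g q' - g q - dg q * (h * (z - p)))))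
          with (Re (c * g q') - Re (c * g q) - h * Re (c * (dg q * (z - p)))).
        - field; auto.
        - rewrite <- re_scal_l.
          replace (c * (g q' - g q - dg q * (h * (z - p))))%C
            with (c * g q' + - (c * g q) + - (h * (c * (dg q * (z - p)))))%C by ring.
          rewrite !re_plus, !re_opp. ring. }
    assert (Hpos := Rabs_pos_lt h Nh).
    unfold Rdiv at 1. rewrite Rabs_mult, Rabs_inv.
    apply (Rmult_lt_reg_r (Rabs h)); auto.
    rewrite Rmult_assoc, Rinv_l by lra. rewrite Rmult_1_r.
    eapply Rle_lt_trans; [apply re_le_Cmod|]. rewrite Cmod_mult, Hc, Rmult_1_l.
    eapply Rle_lt_trans; [exact K|].
    assert (eps / (2 * (1 + Cmod (z - p))) * Cmod (z - p) < eps).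
    { unfold Rdiv. rewrite Rmult_assoc, (Rmult_comm (/ _)).
      rewrite <- (Rmult_1_r eps) at 2. apply Rmult_lt_compat_l; auto.
      apply (Rmult_lt_reg_r (2 * (1 + Cmod (z - p)))); [lra|].
      rewrite Rmult_assoc, Rinv_l by lra. lra. }
    nra. }
  destruct (MVT_gen th 0 1 dth) as [s [Hs E]].
  - intros x Hx. rewrite Rmin_left, Rmax_right in Hx by lra. apply D. lra.
  - intros x Hx. rewrite Rmin_left, Rmax_right in Hx by lra.
    apply derivable_continuous_pt. exists (dth x). apply is_derive_Reals. apply D. lra.
  - rewrite Rmin_left, Rmax_right in Hs by lra.
    assert (F : th 1 - th 0 = Cmod (g z - g p)).
    { unfold th. replace (p + 1 * (z - p))%C with z by ring.
      replace (p + 0 * (z - p))%C with p by ring.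
      replace (Re (c * g z) - Re (c * g p)) with (Re (c * (g z - g p))).
      - rewrite Ec. apply re_RtoC.
      - replace (c * (g z - g p))%C with (c * g z + - (c * g p))%C by ring.
        rewrite re_plus, re_opp. ring. }
    rewrite F in E. rewrite E.
    replace (dth s * (1 - 0)) with (dth s) by ring.
    eapply Rle_trans; [apply Rle_abs|]. eapply Rle_trans; [apply re_le_Cmod|].
    rewrite !Cmod_mult, Hc, Rmult_1_l. apply Rmult_le_compat_r; [apply Cmod_ge_0|].
    now apply HB.
Qed.

(** * Goursat's theorem and the maximum principle *)

Lemma ccont_continuous_Re (F : C -> C) (x y : R) :
  ccont F (x, y) -> continuous (fun t => Re (F (t, y))) x.
Proof.
  intros H. apply filterlim_locally. intros eps.
  destruct (H eps (cond_pos eps)) as [d [Hd K]]. exists (mkposreal d Hd).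
  intros t Ht. change (Rabs (t - x) < d) in Ht.
  change (Rabs (Re (F (t, y)) - Re (F (x, y))) < eps).
  eapply Rle_lt_trans; [|apply (K (t, y)); now rewrite Cmod_pair_fst].
  eapply Rle_trans; [|apply re_le_Cmod].
  unfold Cminus. rewrite re_plus, re_opp. apply Rle_refl.
Qed.

Lemma ccont_continuous_Im (F : C -> C) (x y : R) :
  ccont F (x, y) -> continuous (fun t => Im (F (x, t))) y.
Proof.
  intros H. apply filterlim_locally. intros eps.
  destruct (H eps (cond_pos eps)) as [d [Hd K]]. exists (mkposreal d Hd).
  intros t Ht. change (Rabs (t - y) < d) in Ht.
  change (Rabs (Im (F (x, t)) - Im (F (x, y))) < eps).
  eapply Rle_lt_trans; [|apply (K (x, t)); now rewrite Cmod_pair_snd].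
  eapply Rle_trans; [|apply im_le_Cmod].
  unfold Cminus. rewrite im_plus, im_opp. apply Rle_refl.
Qed.

Lemma RInt_near_const (h : R -> R) (a b k e : R) :
  a <= b -> ex_RInt h a b -> (forall x, a < x < b -> Rabs (h x - k) <= e) ->
  Rabs (RInt h a b - k * (b - a)) <= e * (b - a).
Proof.
  intros Hab Hex H.
  assert (A : RInt h a b <= (b - a) * (k + e)).
  { rewrite <- (RInt_const a b (k + e) : _ = (b - a) * (k + e)).
    apply RInt_le; auto. apply ex_RInt_const.
    intros x Hx. specialize (H x Hx). apply Rabs_le_between in H. lra. }
  assert (B : (b - a) * (k - e) <= RInt h a b).
  { rewrite <- (RInt_const a b (k - e) : _ = (b - a) * (k - e)).
    apply RInt_le; auto. apply ex_RInt_const.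
    intros x Hx. specialize (H x Hx). apply Rabs_le_between in H. lra. }
  apply Rabs_le. lra.
Qed.

(* The real part of the integral of [F dz] along the boundary of
   [a, b] x [c, d], horizontal and vertical sides being grouped. *)
Definition rect_integral (F : C -> C) (a b c d : R) : R :=
  RInt (fun x => Re (F (x, c)) - Re (F (x, d))) a b
  - RInt (fun y => Im (F (b, y)) - Im (F (a, y))) c d.

Definition ccont_on_rect (F : C -> C) (a b c d : R) : Prop :=
  forall x y, a <= x <= b -> c <= y <= d -> ccont F (x, y).

Lemma ex_RInt_hor (F : C -> C) (a b c d : R) :
  a <= b -> c <= d -> ccont_on_rect F a b c d ->
  ex_RInt (fun x => Re (F (x, c)) - Re (F (x, d))) a b.
Proof.
  intros Hab Hcd H. apply (ex_RInt_continuous (V := R_CompleteNormedModule)).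
  intros z Hz. rewrite Rmin_left, Rmax_right in Hz by lra.
  apply (continuous_minus (V := R_NormedModule));
  apply ccont_continuous_Re; apply H; lra.
Qed.

Lemma ex_RInt_ver (F : C -> C) (a b c d : R) :
  a <= b -> c <= d -> ccont_on_rect F a b c d ->
  ex_RInt (fun y => Im (F (b, y)) - Im (F (a, y))) c d.
Proof.
  intros Hab Hcd H. apply (ex_RInt_continuous (V := R_CompleteNormedModule)).
  intros z Hz. rewrite Rmin_left, Rmax_right in Hz by lra.
  apply (continuous_minus (V := R_NormedModule));
  apply ccont_continuous_Im; apply H; lra.
Qed.

Lemma rect_integral_split_x (F : C -> C) (a m b c d : R) :
  a <= m <= b -> c <= d -> ccont_on_rect F a b c d ->
  rect_integral F a b c d = rect_integral F a m c d + rect_integral F m b c d.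
Proof.
  intros Hm Hcd H. unfold rect_integral.
  assert (H1 : ccont_on_rect F a m c d) by (intros x y ? ?; apply H; lra).
  assert (H2 : ccont_on_rect F m b c d) by (intros x y ? ?; apply H; lra).
  rewrite <- (RInt_Chasles (V := R_CompleteNormedModule)
    (fun x => Re (F (x, c)) - Re (F (x, d))) a m b); try (apply ex_RInt_hor; auto; lra).
  rewrite (RInt_ext (fun y => Im (F (b, y)) - Im (F (a, y)))
    (fun y => plus (Im (F (m, y)) - Im (F (a, y))) (Im (F (b, y)) - Im (F (m, y))))).
  - rewrite (RInt_plus (V := R_CompleteNormedModule)); try (apply ex_RInt_ver; auto; lra).
    unfold plus; simpl. ring.
  - intros. unfold plus; simpl. ring.
Qed.

Lemma rect_integral_split_y (F : C -> C) (a b c m d : R) :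
  c <= m <= d -> a <= b -> ccont_on_rect F a b c d ->
  rect_integral F a b c d = rect_integral F a b c m + rect_integral F a b m d.
Proof.
  intros Hm Hcd H. unfold rect_integral.
  assert (H1 : ccont_on_rect F a b c m) by (intros x y ? ?; apply H; lra).
  assert (H2 : ccont_on_rect F a b m d) by (intros x y ? ?; apply H; lra).
  rewrite <- (RInt_Chasles (V := R_CompleteNormedModule)
    (fun y => Im (F (b, y)) - Im (F (a, y))) c m d); try (apply ex_RInt_ver; auto; lra).
  rewrite (RInt_ext (fun x => Re (F (x, c)) - Re (F (x, d)))
    (fun x => plus (Re (F (x, c)) - Re (F (x, m))) (Re (F (x, m)) - Re (F (x, d))))).
  - rewrite (RInt_plus (V := R_CompleteNormedModule)); try (apply ex_RInt_hor; auto; lra).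
    unfold plus; simpl. ring.
  - intros. unfold plus; simpl. ring.
Qed.

(* The boundary integral of the affine map [p + l * (w - z)] vanishes. *)
Lemma rect_integral_near_affine (F : C -> C) (a b c d e : R) (z p l : C) :
  a <= b -> c <= d -> ccont_on_rect F a b c d ->
  (forall x y, a <= x <= b -> c <= y <= d ->
     Cmod (F (x, y) - p - l * ((x, y) - z)) <= e) ->
  Rabs (rect_integral F a b c d) <= 2 * e * ((b - a) + (d - c)).
Proof.
  intros Hab Hcd Hc H.
  assert (A : Rabs (RInt (fun x => Re (F (x, c)) - Re (F (x, d))) a b
                - Im l * (d - c) * (b - a)) <= 2 * e * (b - a)).
  { apply RInt_near_const; auto; [now apply ex_RInt_hor|]. intros x Hx.
    assert (U := H x c ltac:(lra) ltac:(lra)). assert (V := H x d ltac:(lra) ltac:(lra)).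
    replace (Re (F (x, c)) - Re (F (x, d)) - Im l * (d - c)) with
      (Re (F (x, c) - p - l * ((x, c) - z)) - Re (F (x, d) - p - l * ((x, d) - z)))
      by (unfold Re, Im, Cminus, Cplus, Cmult, Copp; simpl; ring).
    eapply Rle_trans; [apply Rabs_triang|]. rewrite Rabs_Ropp.
    generalize (re_le_Cmod (F (x, c) - p - l * ((x, c) - z))).
    generalize (re_le_Cmod (F (x, d) - p - l * ((x, d) - z))). lra. }
  assert (B : Rabs (RInt (fun y => Im (F (b, y)) - Im (F (a, y))) c d
                - Im l * (b - a) * (d - c)) <= 2 * e * (d - c)).
  { apply RInt_near_const; auto; [now apply ex_RInt_ver|]. intros y Hy.
    assert (U := H b y ltac:(lra) ltac:(lra)). assert (V := H a y ltac:(lra) ltac:(lra)).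
    replace (Im (F (b, y)) - Im (F (a, y)) - Im l * (b - a)) with
      (Im (F (b, y) - p - l * ((b, y) - z)) - Im (F (a, y) - p - l * ((a, y) - z)))
      by (unfold Re, Im, Cminus, Cplus, Cmult, Copp; simpl; ring).
    eapply Rle_trans; [apply Rabs_triang|]. rewrite Rabs_Ropp.
    generalize (im_le_Cmod (F (b, y) - p - l * ((b, y) - z))).
    generalize (im_le_Cmod (F (a, y) - p - l * ((a, y) - z))). lra. }
  unfold rect_integral. apply Rabs_le_between in A. apply Rabs_le_between in B.
  apply Rabs_le. lra.
Qed.

Lemma Rabs_quarter (x y z t : R) (k : R) :
  4 * k <= Rabs (x + y + (z + t)) ->
  k <= Rabs x \/ k <= Rabs y \/ k <= Rabs z \/ k <= Rabs t.
Proof.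
  intros H. generalize (Rabs_triang (x + y) (z + t)) (Rabs_triang x y) (Rabs_triang z t).
  intros. destruct (Rle_dec k (Rabs x)); auto. destruct (Rle_dec k (Rabs y)); auto.
  destruct (Rle_dec k (Rabs z)); auto. right; right; right. lra.
Qed.

Section Bisection.

Variable F : C -> C.
Variables (a0 c0 W H K : R).
Hypothesis HW : 0 <= W.
Hypothesis HH : 0 <= H.
Hypothesis Hc : ccont_on_rect F a0 (a0 + W) c0 (c0 + H).

(** A rectangle of generation [n] is encoded by its lower left corner alone, its sides being fixed
    by [n]. The factor [/4] per generation is what one of four quarters must retain. *)
Definition large_subrect (n : nat) (p : R * R) : Prop :=
  a0 <= fst p /\ fst p + W * (/2)^n <= a0 + W /\
  c0 <= snd p /\ snd p + H * (/2)^n <= c0 + H /\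
  K * (/4)^n <= Rabs (rect_integral F (fst p) (fst p + W * (/2)^n)
                                     (snd p) (snd p + H * (/2)^n)).

Lemma half_pow_pos (n : nat) : 0 < (/2)^n.
Proof. apply pow_lt. lra. Qed.

Lemma large_subrect_step (n : nat) (p : R * R) :
  large_subrect n p -> exists p', large_subrect (S n) p' /\
    fst p <= fst p' /\ fst p' + W * (/2)^(S n) <= fst p + W * (/2)^n /\
    snd p <= snd p' /\ snd p' + H * (/2)^(S n) <= snd p + H * (/2)^n.
Proof.
  destruct p as [a c]. unfold large_subrect; simpl fst; simpl snd.
  intros (H1 & H2 & H3 & H4 & H5).
  assert (P := half_pow_pos n).
  set (s := (/2)^n) in *.
  replace ((/2)^(S n)) with (s / 2) by (unfold s; simpl; field).
  replace (K * (/4)^(S n)) with ((K * (/4)^n) / 4) by (simpl; field).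
  set (w := W * (s / 2)). set (h := H * (s / 2)).
  assert (Hw : 0 <= w) by (apply Rmult_le_pos; lra).
  assert (Hh : 0 <= h) by (apply Rmult_le_pos; lra).
  replace (W * s) with (w + w) in * by (unfold w; field).
  replace (H * s) with (h + h) in * by (unfold h; field).
  assert (HC : ccont_on_rect F a (a + (w + w)) c (c + (h + h)))
    by (intros x y ? ?; apply Hc; lra).
  rewrite (rect_integral_split_x F a (a + w)) in H5; [|lra|lra|auto].
  rewrite (rect_integral_split_y F a (a + w) c (c + h)) in H5;
    [|lra|lra|intros x y ? ?; apply HC; lra].
  rewrite (rect_integral_split_y F (a + w) _ c (c + h)) in H5;
    [|lra|lra|intros x y ? ?; apply HC; lra].
  replace (a + (w + w)) with (a + w + w) in * by ring.
  replace (c + (h + h)) with (c + h + h) in * by ring.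
  replace (K * (/4)^n) with (4 * (K * (/4)^n / 4)) in H5 by field.
  apply Rabs_quarter in H5. destruct H5 as [Q|[Q|[Q|Q]]];
    [exists (a, c)|exists (a, c + h)|exists (a + w, c)|exists (a + w, c + h)];
    simpl fst; simpl snd; repeat split; try lra; exact Q.
Qed.

Lemma bisection_limit :
  large_subrect 0 (a0, c0) ->
  exists u v, forall n, exists p, large_subrect n p /\
    fst p <= u <= fst p + W * (/2)^n /\ snd p <= v <= snd p + H * (/2)^n.
Proof.
  intros H0.
  set (next := fun n (q : {p | large_subrect n p}) =>
    let (p', Hp') := constructive_indefinite_description _
                       (large_subrect_step n (proj1_sig q) (proj2_sig q)) in
    exist (large_subrect (S n)) p' (proj1 Hp')).
  set (sq := fix sq n : {p | large_subrect n p} :=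
    match n with O => exist _ _ H0 | S n => next n (sq n) end).
  set (al := fun n => fst (proj1_sig (sq n))). set (ga := fun n => snd (proj1_sig (sq n))).
  assert (ST : forall n, al n <= al (S n) /\ al (S n) + W * (/2)^(S n) <= al n + W * (/2)^n /\
      ga n <= ga (S n) /\ ga (S n) + H * (/2)^(S n) <= ga n + H * (/2)^n).
  { intros n. unfold al, ga. simpl sq. unfold next.
    destruct (constructive_indefinite_description _ _) as [p' Hp'].
    exact (proj2 Hp'). }
  assert (nested : forall (be : nat -> R) (L : R), 0 <= L ->
    (forall n, be n <= be (S n) /\ be (S n) + L * (/2)^(S n) <= be n + L * (/2)^n) ->
    exists u, forall n, be n <= u <= be n + L * (/2)^n).
  { intros be L HL S.
    assert (M : forall n k, be n <= be (n + k)%nat /\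
                be (n + k)%nat + L * (/2)^(n + k) <= be n + L * (/2)^n).
    { intros n. induction k.
      - rewrite Nat.add_0_r. lra.
      - rewrite Nat.add_succ_r. specialize (S (n + k)%nat). lra. }
    assert (B : forall n m, be m <= be n + L * (/2)^n).
    { intros n m.
      assert (P := Rmult_le_pos _ _ HL (Rlt_le _ _ (half_pow_pos n))).
      assert (P' := Rmult_le_pos _ _ HL (Rlt_le _ _ (half_pow_pos m))).
      destruct (Nat.le_ge_cases n m) as [E|E].
      - destruct (M n (m - n)%nat) as [_ Q]. replace (n + (m - n))%nat with m in Q by lia. lra.
      - destruct (M m (n - m)%nat) as [Q _]. replace (m + (n - m))%nat with n in Q by lia. lra. }
    destruct (completeness (fun x => exists n, x = be n)) as [u [U1 U2]].
    - exists (be O + L * (/2)^0). intros x [n ->]. apply B.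
    - exists (be O). now exists O.
    - exists u. intros n. split; [apply U1; eauto|]. apply U2. intros x [m ->]. apply B. }
  destruct (nested al W HW) as [u Hu]; [intros n; destruct (ST n); lra|].
  destruct (nested ga H HH) as [v Hv]; [intros n; destruct (ST n) as (?&?&?&?); lra|].
  exists u, v. intros n. exists (proj1_sig (sq n)). split; [apply proj2_sig|].
  split; [apply Hu|apply Hv].
Qed.

End Bisection.

(** At generation [n], with [s = (/2)^n], the map is affine up to an error of order [e * s] near the
    limit point and the boundary has length of order [s]. The integral is then of order [e * s * s],
    while bisection keeps it above [K * s * s]. *)
Theorem goursat (F : C -> C) (a b c d : R) :
  a <= b -> c <= d ->
  (forall x y, a <= x <= b -> c <= y <= d -> exists l, cderiv F (x, y) l) ->
  rect_integral F a b c d = 0.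
Proof.
  intros Hab Hcd HF.
  assert (Hc : ccont_on_rect F a b c d).
  { intros x y Hx Hy. destruct (HF x y Hx Hy) as [l Hl]. now apply cderiv_ccont in Hl. }
  set (W := b - a). set (H := d - c).
  assert (HW : 0 <= W) by (unfold W; lra). assert (HH : 0 <= H) by (unfold H; lra).
  replace b with (a + W) in * by (unfold W; ring).
  replace d with (c + H) in * by (unfold H; ring).
  clearbody W H. clear b d Hab Hcd.
  set (K := Rabs (rect_integral F a (a + W) c (c + H))).
  destruct (bisection_limit F a c W H K HW HH Hc) as (u & v & Huv).
  { unfold large_subrect; simpl. rewrite !Rmult_1_r. repeat split; try lra.
    apply Rle_refl. }
  destruct (Huv O) as (p0 & (P1 & P2 & P3 & P4 & _) & U0 & V0).
  destruct (HF u v) as [l Hl]; [lra|lra|].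
  assert (E : forall eps, 0 < eps -> K <= eps).
  { intros eps He.
    (* The argument ends with [K <= 2 * e * (W + H)^2]; the added 1 keeps the denominator positive
       for a degenerate rectangle. *)
    set (e := eps / (2 * (W + H + 1) * (W + H + 1))).
    assert (Hpos : 0 < 2 * (W + H + 1) * (W + H + 1)) by nra.
    assert (HE : 0 < e) by now apply Rdiv_lt_0_compat.
    destruct (cderiv_eps _ _ _ Hl e HE) as [dl [Hdl Q]].
    destruct (pow_lt_1_zero (/2) ltac:(rewrite Rabs_pos_eq; lra) (dl / (W + H + 1)))
      as [n Hn]; [apply Rdiv_lt_0_compat; lra|].
    specialize (Hn n ltac:(lia)). assert (Pn := half_pow_pos n).
    rewrite Rabs_pos_eq in Hn by lra. apply Rlt_div_r in Hn; [|lra].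
    destruct (Huv n) as ([a' c'] & (A1 & A2 & A3 & A4 & A5) & U & V).
    simpl fst in *. simpl snd in *.
    set (s := (/2)^n) in *.
    assert (near : forall x y, a' <= x <= a' + W * s -> c' <= y <= c' + H * s ->
       Cmod ((x, y) - (u, v)) <= (W + H) * s).
    { intros x y Hx Hy. eapply Rle_trans; [apply Cmod_le_Re_Im|].
      unfold Re, Im; simpl.
      assert (Rabs (x + - u) <= W * s) by (apply Rabs_le; lra).
      assert (Rabs (y + - v) <= H * s) by (apply Rabs_le; lra). lra. }
    assert (Ws : 0 <= W * s) by nra. assert (Hs : 0 <= H * s) by nra.
    assert (S := rect_integral_near_affine F a' (a' + W * s) c' (c' + H * s)
      (e * ((W + H) * s)) (u, v) (F (u, v)) l ltac:(lra) ltac:(lra)).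
    assert (S' := Rle_trans _ _ _ A5 (S ltac:(intros x y ? ?; apply Hc; lra) ltac:(
      intros x y Hx Hy; assert (N := near x y Hx Hy);
      eapply Rle_trans; [apply Q; nra|]; apply Rmult_le_compat_l; [lra|exact N]))).
    replace ((/4)^n) with (s * s) in S' by (unfold s; rewrite <- Rpow_mult_distr; f_equal; lra).
    assert (K <= 2 * e * ((W + H) * (W + H))).
    { apply (Rmult_le_reg_r (s * s)); [nra|]. eapply Rle_trans; [exact S'|].
      right; ring. }
    replace eps with (e * (2 * (W + H + 1) * (W + H + 1))) by (unfold e; field; lra).
    nra. }
  assert (Z : K = 0).
  { apply Rle_antisym; [|apply Rabs_pos]. apply Rnot_lt_le. intros L.
    specialize (E (K / 2) ltac:(lra)). lra. }
  apply Rabs_eq_0. exact Z.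
Qed.

(** * The complex exponential, circle means and the Borel-Caratheodory inequality *)

Definition Cexp (z : C) : C := (exp (Re z) * cos (Im z), exp (Re z) * sin (Im z)).

Lemma Cexp_plus (z w : C) : Cexp (z + w) = (Cexp z * Cexp w)%C.
Proof.
  unfold Cexp. rewrite re_plus, im_plus, exp_plus, cos_plus, sin_plus.
  apply injective_projections; simpl; ring.
Qed.

Lemma Cexp_0 : Cexp 0 = 1.
Proof.
  unfold Cexp, Re, Im; simpl. rewrite exp_0, cos_0, sin_0.
  apply injective_projections; simpl; ring.
Qed.

Lemma Cmod_Cexp (z : C) : Cmod (Cexp z) = exp (Re z).
Proof.
  unfold Cmod, Cexp; simpl.
  replace (_ + _) with (exp (Re z) * exp (Re z)).
  - apply sqrt_square. left; apply exp_pos.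
  - transitivity (exp (Re z) * exp (Re z) * (Rsqr (sin (Im z)) + Rsqr (cos (Im z)))).
    + rewrite sin2_cos2. ring.
    + unfold Rsqr; ring.
Qed.

Lemma Cexp_nonzero (z : C) : Cexp z <> 0.
Proof. apply Cmod_gt_0. rewrite Cmod_Cexp. apply exp_pos. Qed.

Lemma Cexp_opp (z : C) : Cexp (- z) = (/ Cexp z)%C.
Proof.
  assert (E : (Cexp z * Cexp (- z) = 1)%C).
  { rewrite <- Cexp_plus. replace (z + - z)%C with (RtoC 0) by ring. apply Cexp_0. }
  replace (/ Cexp z)%C with (/ Cexp z * (Cexp z * Cexp (- z)))%C by (rewrite E; ring).
  field. apply Cexp_nonzero.
Qed.

Lemma derivable_eps_0 (f : R -> R) (l : R) :
  derivable_pt_lim f 0 l -> forall e, 0 < e -> exists d, 0 < d /\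
    forall h, Rabs h < d -> Rabs (f h - f 0 - l * h) <= e * Rabs h.
Proof.
  intros D e He. destruct (D e He) as [d Hd]. exists d. split; [apply cond_pos|].
  intros h Hh. destruct (Req_dec h 0) as [->|N].
  - rewrite Rabs_R0. replace (f 0 - f 0 - l * 0) with 0 by ring. rewrite Rabs_R0. lra.
  - specialize (Hd h N Hh). rewrite Rplus_0_l in Hd.
    replace (f h - f 0 - l * h) with (((f h - f 0) / h - l) * h) by (field; auto).
    rewrite Rabs_mult. apply Rmult_le_compat_r; [apply Rabs_pos|lra].
Qed.

Lemma cderiv_Cexp_0 : cderiv Cexp 0 1.
Proof.
  apply eps_cderiv. intros eps He.
  (* The error terms collected below add up to at most [9 * e * m]; the bound [e <= 1] is what gives
     [exp x <= 3]. *)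
  set (e := Rmin 1 (eps / 20)).
  assert (P : 0 < e) by (apply Rmin_pos; lra).
  assert (P1 : e <= 1) by apply Rmin_l. assert (P2 : e <= eps / 20) by apply Rmin_r.
  clearbody e.
  assert (De : derivable_pt_lim exp 0 1) by (rewrite <- exp_0; apply derivable_pt_lim_exp).
  assert (Dc : derivable_pt_lim cos 0 0).
  { replace 0 with (- sin 0) at 2 by (rewrite sin_0; ring). apply derivable_pt_lim_cos. }
  assert (Ds : derivable_pt_lim sin 0 1) by (rewrite <- cos_0; apply derivable_pt_lim_sin).
  destruct (derivable_eps_0 exp 1 De e P) as [d1 [D1 K1]].
  destruct (derivable_eps_0 cos 0 Dc e P) as [d2 [D2 K2]].
  destruct (derivable_eps_0 sin 1 Ds e P) as [d3 [D3 K3]].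
  exists (Rmin e (Rmin d1 (Rmin d2 d3))). split; [repeat apply Rmin_pos; auto|].
  intros w Hw. replace (w - 0)%C with w in * by ring.
  set (x := Re w). set (y := Im w).
  assert (Hx : Rabs x <= Cmod w) by apply re_le_Cmod.
  assert (Hy : Rabs y <= Cmod w) by apply im_le_Cmod.
  assert (M1 := Rlt_le_trans _ _ _ Hw (Rmin_l _ _)).
  assert (M2 := Rlt_le_trans _ _ _ Hw (Rmin_r _ _)).
  assert (M3 := Rlt_le_trans _ _ _ M2 (Rmin_l _ _)).
  assert (M4 := Rlt_le_trans _ _ _ M2 (Rmin_r _ _)).
  assert (M5 := Rlt_le_trans _ _ _ M4 (Rmin_l _ _)).
  assert (M6 := Rlt_le_trans _ _ _ M4 (Rmin_r _ _)).
  specialize (K1 x ltac:(lra)). specialize (K2 y ltac:(lra)). specialize (K3 y ltac:(lra)).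
  rewrite exp_0 in K1. rewrite cos_0 in K2. rewrite sin_0 in K3.
  assert (EX : 0 < exp x <= 3).
  { split; [apply exp_pos|]. apply Rabs_le_between in K1.
    assert (x <= 1) by (generalize (Rle_abs x); lra). nra. }
  rewrite Cexp_0.
  eapply Rle_trans; [apply Cmod_le_Re_Im|].
  replace (Re (Cexp w - 1 - 1 * w)) with
    ((exp x - 1 - 1 * x) + exp x * (cos y - 1 - 0 * y)).
  2:{ unfold x, y, Cexp, Re, Im; simpl. ring. }
  replace (Im (Cexp w - 1 - 1 * w)) with
    (exp x * (sin y - 0 - 1 * y) + (exp x - 1 - 1 * x) * y + x * y).
  2:{ unfold x, y, Cexp, Re, Im; simpl. ring. }
  assert (T1 := Rabs_triang (exp x - 1 - 1 * x) (exp x * (cos y - 1 - 0 * y))).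
  assert (T2 := Rabs_triang (exp x * (sin y - 0 - 1 * y) + (exp x - 1 - 1 * x) * y) (x * y)).
  assert (T3 := Rabs_triang (exp x * (sin y - 0 - 1 * y)) ((exp x - 1 - 1 * x) * y)).
  rewrite Rabs_mult in T1, T3. rewrite Rabs_mult in T2. rewrite (Rabs_mult _ y) in T3.
  rewrite (Rabs_pos_eq (exp x)) in * by lra.
  set (m := Cmod w) in *.
  assert (B1 : Rabs (exp x - 1 - 1 * x) <= e * m) by nra.
  assert (B2 : Rabs (cos y - 1 - 0 * y) <= e * m) by nra.
  assert (B3 : Rabs (sin y - 0 - 1 * y) <= e * m) by nra.
  assert (m0 : 0 <= m) by apply Cmod_ge_0.
  assert (C1 : exp x * Rabs (cos y - 1 - 0 * y) <= 3 * (e * m))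
    by (apply Rmult_le_compat; auto using Rabs_pos; lra).
  assert (C2 : exp x * Rabs (sin y - 0 - 1 * y) <= 3 * (e * m))
    by (apply Rmult_le_compat; auto using Rabs_pos; lra).
  assert (C3 : Rabs (exp x - 1 - 1 * x) * Rabs y <= (e * m) * 1)
    by (apply Rmult_le_compat; auto using Rabs_pos; lra).
  assert (C4 : Rabs x * Rabs y <= e * m)
    by (apply Rmult_le_compat; auto using Rabs_pos; lra).
  assert (e * m <= eps / 20 * m) by (apply Rmult_le_compat_r; lra).
  nra.
Qed.

Lemma cderiv_Cexp (z : C) : cderiv Cexp z (Cexp z).
Proof.
  apply (cderiv_ext_loc (fun w => Cexp z * Cexp (- z + w))%C _ z _ 1); [lra| |].
  - intros w _. rewrite <- Cexp_plus. f_equal. ring.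
  - apply (eq_ind (Cexp z * 1)%C (cderiv _ z)); [|ring]. apply cderiv_scal.
    apply cderiv_translate. replace (- z + z)%C with (RtoC 0) by ring.
    apply cderiv_Cexp_0.
Qed.

(* Pulling back by [Cexp], Goursat on a rectangle of height [2 PI] shows that
   the mean of [Re q] over a circle does not depend on the radius; for small
   radii it is close to [Re (q 0)]. *)
Theorem max_principle_Re (q : C -> C) (R0 r m : R) :
  0 < r < R0 -> ccont q 0 ->
  (forall z, 0 < Cmod z < R0 -> exists l, cderiv q z l) ->
  (forall z, Cmod z = r -> Re (q z) <= m) ->
  Re (q 0) <= m.
Proof.
  intros Hr Hc Hd Hm. apply Rnot_lt_le. intros L.
  set (e := (Re (q 0) - m) / 2).
  destruct (Hc e) as [d [Hd0 K]]; [unfold e; lra|].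
  set (r1 := Rmin r (d / 2)).
  assert (P1 : 0 < r1) by (apply Rmin_pos; lra).
  assert (Q1 : r1 <= r) by apply Rmin_l. assert (Q2 : r1 <= d / 2) by apply Rmin_r.
  assert (Lr : ln r1 <= ln r).
  { destruct Q1 as [Q1| ->]; [|lra]. left. now apply ln_increasing. }
  (* The factor [Ci] moves the real part of [q] into the imaginary part of [F], which is what is
     integrated along vertical sides; these are mapped to circles. The two horizontal sides have the
     same image and cancel. *)
  set (F := fun w => (Ci * q (Cexp w))%C).
  assert (PI0 := PI_RGT_0).
  assert (HF : forall x y, ln r1 <= x <= ln r -> 0 <= y <= 2 * PI ->
            exists l, cderiv F (x, y) l).
  { intros x y Hx Hy. destruct (Hd (Cexp (x, y))) as [l Hl].
    - rewrite Cmod_Cexp. split; [apply exp_pos|]. apply Rle_lt_trans with r; [|lra].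
      rewrite <- (exp_ln r) by lra. destruct (proj2 Hx) as [M| M].
      + left. now apply exp_increasing.
      + unfold Re; simpl. rewrite M. lra.
    - eexists. apply cderiv_scal. apply cderiv_comp; [apply cderiv_Cexp|exact Hl]. }
  assert (G := goursat F (ln r1) (ln r) 0 (2 * PI) Lr ltac:(lra) HF).
  unfold rect_integral in G.
  rewrite (RInt_ext _ (fun _ => 0)) in G.
  2:{ intros x _. unfold F, Cexp. simpl Re at 2 4. simpl Im.
      unfold Re, Im; simpl. rewrite cos_0, sin_0, cos_2PI, sin_2PI. ring. }
  rewrite RInt_const in G. change (scal (ln r - ln r1) 0) with ((ln r - ln r1) * 0) in G.
  assert (A : Rabs (RInt (fun y => Im (F (ln r, y)) - Im (F (ln r1, y))) 0 (2 * PI)) <= 0).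
  { apply Rabs_le. lra. }
  assert (B : RInt (fun y => Im (F (ln r, y)) - Im (F (ln r1, y))) 0 (2 * PI)
              <= (2 * PI - 0) * - e).
  { rewrite <- (RInt_const 0 (2 * PI) (- e) : _ = (2 * PI - 0) * - e).
    apply RInt_le; [lra| |apply ex_RInt_const|].
    - apply ex_RInt_ver; try lra. intros x y Hx Hy.
      destruct (HF x y Hx Hy) as [l Hl]. now apply cderiv_ccont in Hl.
    - intros y _.
      assert (U : Re (q (Cexp (ln r, y))) <= m).
      { apply Hm. rewrite Cmod_Cexp. simpl. apply exp_ln. lra. }
      assert (V := K (Cexp (ln r1, y))).
      replace (Cexp (ln r1, y) - 0)%C with (Cexp (ln r1, y)) in V by ring.
      rewrite Cmod_Cexp in V. simpl in V. rewrite exp_ln in V by lra.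
      specialize (V ltac:(lra)).
      assert (V' := Rle_lt_trans _ _ _ (re_le_Cmod _) V).
      unfold Cminus in V'. rewrite re_plus, re_opp in V'. apply Rabs_def2 in V'.
      unfold F. rewrite !im_mult. unfold Re at 1 3, Im at 2 4; simpl. unfold e in *. lra. }
  apply Rabs_le_between in A. unfold e in *. nra.
Qed.

(** The auxiliary [q] encodes the positive kernel [1 + cos]. On the circle it is [L z - L 0] times a
    real factor in [0, 4], so a one-sided bound on [Re L] suffices; at 0 its real part is
    [r * Cmod l], the unimodular [c] having rotated [l] to the positive axis. As [q] contains the
    difference quotient [psi], only continuity is at hand at 0, the form in which the maximum
    principle is stated. *)
Theorem borel_caratheodory (L : C -> C) (l : C) (R0 r K : R) :
  0 < r < R0 ->
  (forall z, Cmod z < R0 -> exists k, cderiv L z k) -> cderiv L 0 l ->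
  (forall z, Cmod z = r -> Re (L z) <= K) ->
  r * Cmod l <= 4 * (K - Re (L 0)).
Proof.
  intros Hr HL Hl HK.
  assert (HR0 : Cmod 0 < R0) by (rewrite Cmod_0; lra).
  assert (M0 : Re (L 0) <= K).
  { apply (max_principle_Re L R0 r K Hr); auto.
    - now apply cderiv_ccont in Hl.
    - intros z Hz. apply HL. lra. }
  destruct (Ceq_dec l 0) as [->|N]; [rewrite Cmod_0; lra|].
  assert (Pl := proj1 (Cmod_gt_0 _) N).
  assert (Nl : RtoC (Cmod l) <> 0) by (intro Q; apply RtoC_inj in Q; lra).
  assert (Nr : RtoC r <> 0) by (intro Q; apply RtoC_inj in Q; lra).
  destruct Hl as (phi & Hphi & Ephi & d & Hd & Eq).
  set (c := (Cconj l / Cmod l)%C).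
  assert (Hc1 : Cmod c = 1).
  { unfold c. rewrite Cmod_div, Cmod_conj, Cmod_R, Rabs_pos_eq; auto; try lra. field; lra. }
  assert (Hcl : (c * l)%C = Cmod l).
  { unfold c. replace (Cconj l / Cmod l * l)%C with ((l * Cconj l) / Cmod l)%C by (field; auto).
    rewrite <- Cmod2_conj, RtoC_pow. field; auto. }
  set (psi := fun z => if Ceq_dec z 0 then l else ((L z - L 0) / z)%C).
  set (q := fun z => (c * r * psi z + Cconj c / r * (z * (L z - L 0)) + 2 * (L z - L 0))%C).
  assert (q0 : Re (q 0) = r * Cmod l).
  { unfold q, psi. destruct (Ceq_dec 0 0) as [_|]; [|tauto].
    replace (c * r * l + Cconj c / r * (0 * (L 0 - L 0)) + 2 * (L 0 - L 0))%C
      with (r * (c * l))%C by (field; auto).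
    rewrite Hcl, re_scal_l, re_RtoC. auto. }
  rewrite <- q0.
  assert (Lc : ccont L 0). { destruct (HL 0 HR0) as [k Hk]. now apply cderiv_ccont in Hk. }
  apply (max_principle_Re q R0 r); auto.
  - assert (Hpsi : ccont psi 0).
    { apply (ccont_ext_loc phi psi 0 d Hd); auto. intros w Hw. unfold psi.
      destruct (Ceq_dec w 0) as [->|Nw]; auto.
      rewrite (Eq w Hw). field. auto. }
    unfold q. repeat apply ccont_plus.
    + apply ccont_mult; auto. apply ccont_const.
    + apply ccont_mult; [apply ccont_const|]. apply ccont_mult; [apply ccont_id|].
      apply ccont_minus; auto. apply ccont_const.
    + apply ccont_mult; [apply ccont_const|]. apply ccont_minus; auto. apply ccont_const.
  - intros z Hz. destruct (HL z ltac:(lra)) as [k Hk].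
    assert (Nz : z <> 0) by (apply Cmod_gt_0; lra).
    assert (HD : cderiv (fun z => L z - L 0)%C z (k - 0)).
    { apply cderiv_minus; auto. apply cderiv_const. }
    eexists. unfold q. apply cderiv_plus; [apply cderiv_plus|].
    + apply cderiv_scal.
      eapply (cderiv_ext_loc (fun z => (L z - L 0) * / z)%C _ z _ (Cmod z)); [lra| |].
      * intros w Hw. unfold psi. destruct (Ceq_dec w 0) as [->|]; auto.
        exfalso. rewrite Cmod_sub_sym in Hw. replace (z - 0)%C with z in Hw by ring. lra.
      * apply cderiv_mult; [exact HD|]. apply (cderiv_inv (fun z => z)); [apply cderiv_id|auto].
    + apply cderiv_scal. apply cderiv_mult; [apply cderiv_id|exact HD].
    + apply cderiv_scal. exact HD.
  - intros z Hz. assert (Nz : z <> 0) by (apply Cmod_gt_0; lra).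
    set (D := (L z - L 0)%C).
    set (kap := Re (c * Cconj z) / r).
    (* on |z| = r one has r / z = conj z / r, so the first two terms are conjugate multiples of D *)
    assert (E : q z = (RtoC (2 * (kap + 1)) * D)%C).
    { assert (Nc : Cconj z <> 0) by (apply Cmod_gt_0; rewrite Cmod_conj; lra).
      assert (Z2 : (z * Cconj z = r * r)%C).
      { rewrite <- Cmod2_conj, Hz, <- RtoC_mult. f_equal. ring. }
      assert (Ek : RtoC (2 * kap) = ((c * Cconj z + Cconj c * z) / r)%C).
      { unfold kap, Rdiv. rewrite !RtoC_mult, re_alt, Cmult_conj, Cconj_conj, RtoC_inv by lra.
        field; auto. }
      unfold q, psi. destruct (Ceq_dec z 0) as [|_]; [tauto|]. fold D.
      replace (RtoC (2 * (kap + 1))) with (RtoC (2 * kap) + 2)%C.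
      2:{ rewrite <- RtoC_plus. f_equal. ring. }
      rewrite Ek.
      replace (c * r * (D / z))%C with (c * (Cconj z / r) * D)%C.
      - field. auto.
      - replace (Cconj z)%C with (r * r / z)%C by (rewrite <- Z2; field; auto). field. auto. }
    rewrite E, re_scal_l.
    assert (HD : Re D <= K - Re (L 0)).
    { unfold D, Cminus. rewrite re_plus, re_opp. specialize (HK z Hz). lra. }
    assert (Hk : -1 <= kap <= 1).
    { assert (Q := re_le_Cmod (c * Cconj z)). rewrite Cmod_mult, Cmod_conj, Hc1, Hz in Q.
      apply Rabs_le_between in Q. unfold kap. split.
      - apply Rle_div_r; lra.
      - apply Rle_div_l; lra. }
    nra.
Qed.

(** * Logarithms *)

Lemma ccont_Re (z : C) : ccont (fun w => RtoC (Re w)) z.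
Proof.
  intros e He. exists e. split; auto. intros w Hw.
  replace (RtoC (Re w) - RtoC (Re z))%C with (RtoC (Re (w - z))).
  - rewrite Cmod_R. eapply Rle_lt_trans; [apply re_le_Cmod|exact Hw].
  - unfold Cminus. rewrite re_plus, re_opp, RtoC_plus, RtoC_opp. auto.
Qed.

Lemma ccont_Im (z : C) : ccont (fun w => RtoC (Im w)) z.
Proof.
  intros e He. exists e. split; auto. intros w Hw.
  replace (RtoC (Im w) - RtoC (Im z))%C with (RtoC (Im (w - z))).
  - rewrite Cmod_R. eapply Rle_lt_trans; [apply im_le_Cmod|exact Hw].
  - unfold Cminus. rewrite im_plus, im_opp, RtoC_plus, RtoC_opp. auto.
Qed.

Lemma ccont_Cmod (z : C) : ccont (fun w => RtoC (Cmod w)) z.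
Proof.
  intros e He. exists e. split; auto. intros w Hw.
  rewrite <- RtoC_minus, Cmod_R. eapply Rle_lt_trans; [|exact Hw].
  apply Rabs_le. generalize (Cmod_le_sub w z) (Cmod_le_sub z w).
  rewrite (Cmod_sub_sym z w). lra.
Qed.

Lemma ccont_real_comp (h : R -> R) (g : C -> R) (z : C) :
  continuity_pt h (g z) -> ccont (fun w => RtoC (g w)) z -> ccont (fun w => RtoC (h (g w))) z.
Proof.
  intros Hh Hg e He. destruct (Hh e He) as [d [Hd K]].
  destruct (Hg d Hd) as [d' [Hd' K']]. exists d'. split; auto. intros w Hw.
  specialize (K' w Hw). rewrite <- RtoC_minus, Cmod_R in *.
  destruct (Req_dec (g w) (g z)) as [->|N].
  - rewrite Rminus_diag, Rabs_R0. auto.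
  - apply K. split; [split; [exact I|auto]|exact K'].
Qed.

(** The principal logarithm, on the right half-plane only: elsewhere [atan] of the quotient is not
    the argument. *)
Definition Clog (z : C) : C := (ln (Cmod z), atan (Im z / Re z)).

Lemma Cexp_Clog (z : C) : 0 < Re z -> Cexp (Clog z) = z.
Proof.
  intros H. assert (Nz : z <> 0) by (intros ->; simpl in H; lra).
  assert (P := proj1 (Cmod_gt_0 _) Nz).
  unfold Cexp, Clog; simpl. rewrite exp_ln, cos_atan, sin_atan by auto.
  set (t := Im z / Re z).
  assert (S : Cmod z = Re z * sqrt (1 + t²)).
  { unfold Cmod. change (fst z) with (Re z). change (snd z) with (Im z).
    rewrite <- (sqrt_square (Re z)) at 2 by lra.
    rewrite <- sqrt_mult; [|nra|unfold Rsqr; nra].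
    f_equal. unfold t, Rsqr. field. lra. }
  assert (0 < sqrt (1 + t²)) by (apply sqrt_lt_R0; unfold Rsqr; nra).
  rewrite S. apply injective_projections; unfold fst, snd.
  - change (Re z * sqrt (1 + t²) * (1 / sqrt (1 + t²)) = Re z). field. lra.
  - change (Re z * sqrt (1 + t²) * (t / sqrt (1 + t²)) = Im z). unfold t at 2. field. lra.
Qed.

Lemma ccont_Clog (z : C) : 0 < Re z -> ccont Clog z.
Proof.
  intros H. assert (Nz : z <> 0) by (intros ->; simpl in H; lra).
  assert (P := proj1 (Cmod_gt_0 _) Nz).
  apply (ccont_ext_loc (fun w => RtoC (ln (Cmod w)) + Ci * RtoC (atan (Im w / Re w)))%C _ z (Re z));
    auto.
  - intros w _. apply injective_projections; simpl; ring.
  - apply ccont_plus.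
    + apply (ccont_real_comp ln Cmod); [|apply ccont_Cmod].
      apply derivable_continuous_pt. exists (/ Cmod z). now apply derivable_pt_lim_ln.
    + apply ccont_mult; [apply ccont_const|].
      apply (ccont_real_comp atan (fun w => Im w / Re w)).
      * apply derivable_continuous_pt, derivable_pt_atan.
      * apply (ccont_ext_loc (fun w => RtoC (Im w) * / RtoC (Re w))%C _ z (Re z)); auto.
        -- intros w Hw.
           assert (Q := Rle_lt_trans _ _ _ (re_le_Cmod _) Hw).
           unfold Cminus in Q. rewrite re_plus, re_opp in Q. apply Rabs_def2 in Q.
           rewrite RtoC_div by lra. auto.
        -- apply ccont_mult; [apply ccont_Im|]. apply ccont_inv; [apply ccont_Re|].
           intros E. apply RtoC_inj in E. lra.
Qed.

(** A rotation by 0, [PI] or plus or minus [PI / 2] brings [z] into the right half-plane. The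
    explicit bound on the imaginary part feeds the uniform constants of Schottky's theorem and of
    the annuli argument. *)
Lemma Cexp_log_exists (z : C) : z <> 0 -> exists l, Cexp l = z /\ Rabs (Im l) <= 2 * PI.
Proof.
  intros Nz. assert (P := PI_RGT_0).
  assert (A : forall u, 0 < Re u -> exists l, Cexp l = u /\ Rabs (Im l) <= PI / 2).
  { intros u Hu. exists (Clog u). split; [now apply Cexp_Clog|].
    unfold Clog; simpl. destruct (atan_bound (Im u / Re u)). apply Rabs_le. lra. }
  assert (B : forall t u, 0 < Re u -> Rabs t <= PI ->
            exists l, Cexp l = (u * Cexp (0, t))%C /\ Rabs (Im l) <= 2 * PI).
  { intros t u Hu Ht. destruct (A u Hu) as [l [E Hl]]. exists (l + (0, t))%C. split.
    - now rewrite Cexp_plus, E.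
    - rewrite im_plus. unfold Im at 2; simpl. eapply Rle_trans; [apply Rabs_triang|]. lra. }
  destruct z as [x y].
  destruct (Rtotal_order x 0) as [Hx|[Hx|Hx]].
  - destruct (B PI (- (x, y))%C) as [l [E Hl]]; [simpl; lra|rewrite Rabs_pos_eq; lra|].
    exists l. split; auto. rewrite E. unfold Cexp; simpl. rewrite exp_0, cos_PI, sin_PI.
    apply injective_projections; simpl; ring.
  - subst x. destruct (Rtotal_order y 0) as [Hy|[Hy|Hy]].
    + destruct (B (- (PI / 2)) (- y, 0)) as [l [E Hl]];
        [simpl; lra|rewrite Rabs_Ropp, Rabs_pos_eq; lra|].
      exists l. split; auto. rewrite E. unfold Cexp; simpl.
      rewrite exp_0, cos_neg, sin_neg, cos_PI2, sin_PI2.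
      apply injective_projections; simpl; ring.
    + subst y. exfalso. now apply Nz.
    + destruct (B (PI / 2) (y, 0)) as [l [E Hl]]; [simpl; lra|rewrite Rabs_pos_eq; lra|].
      exists l. split; auto. rewrite E. unfold Cexp; simpl. rewrite exp_0, cos_PI2, sin_PI2.
      apply injective_projections; simpl; ring.
  - destruct (A (x, y)) as [l [E Hl]]; [simpl; lra|]. exists l. split; auto. lra.
Qed.

(** Continuity of a logarithm is enough: its slope is the slope of [g] divided by that of [Cexp] at
    [L z], which does not vanish. *)
Lemma cderiv_lift (L g : C -> C) (z k : C) (d : R) :
  0 < d -> (forall w, Cmod (w - z) < d -> Cexp (L w) = g w) ->
  ccont L z -> cderiv g z k -> cderiv L z (k / g z).
Proof.
  intros Hd E CL (p & Hp & Ep & d1 & Hd1 & K).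
  destruct (cderiv_Cexp (L z)) as (phi & Hphi & Ephi & d2 & Hd2 & K2).
  assert (Ez : Cexp (L z) = g z) by (apply E; rewrite Cmod_sub_diag; auto).
  assert (CP : ccont (fun w => phi (L w)) z) by now apply ccont_comp.
  assert (NP : phi (L z) <> 0) by (rewrite Ephi; apply Cexp_nonzero).
  destruct (ccont_nonzero _ _ CP NP) as [d3 [Hd3 K3]].
  destruct (CL d2 Hd2) as [d4 [Hd4 K4]].
  exists (fun w => p w * / phi (L w))%C. split; [|split].
  - apply ccont_mult; auto. now apply ccont_inv.
  - rewrite Ep, Ephi, Ez. auto.
  - exists (Rmin (Rmin d d1) (Rmin d3 d4)). split; [repeat apply Rmin_pos; auto|].
    intros w Hw.
    assert (M1 := Rlt_le_trans _ _ _ Hw (Rmin_l _ _)).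
    assert (M2 := Rlt_le_trans _ _ _ Hw (Rmin_r _ _)).
    assert (M3 := Rlt_le_trans _ _ _ M1 (Rmin_l _ _)).
    assert (M4 := Rlt_le_trans _ _ _ M1 (Rmin_r _ _)).
    assert (M5 := Rlt_le_trans _ _ _ M2 (Rmin_l _ _)).
    assert (M6 := Rlt_le_trans _ _ _ M2 (Rmin_r _ _)).
    assert (Nw : phi (L w) <> 0).
    { apply Cmod_gt_0. specialize (K3 w M5). generalize (Cmod_ge_0 (phi (L z))). lra. }
    assert (Q := K2 (L w) (K4 w M6)). rewrite (E w M3), Ez, (K w M4) in Q.
    assert (Q' : (p w * (w - z) = phi (L w) * (L w - L z))%C).
    { replace (p w * (w - z))%C with (g z + p w * (w - z) - g z)%C by ring.
      rewrite Q. ring. }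
    replace (p w * / phi (L w) * (w - z))%C with ((p w * (w - z)) * / phi (L w))%C by ring.
    rewrite Q'. field. auto.
Qed.

(** * Compactness of discs and holomorphic logarithms *)

Lemma uniform_continuity_disc (f : C -> C) (R0 r : R) :
  0 < r < R0 -> (forall z, Cmod z < R0 -> ccont f z) ->
  forall e, 0 < e -> exists d, 0 < d /\ forall z z', Cmod z <= r -> Cmod z' <= r ->
    Cmod (z - z') < d -> Cmod (f z - f z') < e.
Proof.
  intros Hr Hc e He.
  (* The gauge must be defined on the whole square, whose corners may leave the domain of [f]; there
     it is so small that no point of the disc comes near. The factor 4 leaves room for [2 * del]
     from the two coordinates and one further step to [z']. *)
  assert (A : forall u v, exists d : posreal, forall w w', Cmod w <= r -> Cmod w' <= r ->
    Cmod (w - (u, v)) < 4 * d -> Cmod (w' - (u, v)) < 4 * d -> Cmod (f w - f w') < e).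
  { intros u v. destruct (Rlt_dec (Cmod (u, v)) R0) as [L|L].
    - destruct (Hc (u, v) L (e / 2)) as [d [Hd K]]; [lra|].
      assert (Hd4 : 0 < d / 4) by lra. exists (mkposreal _ Hd4). simpl.
      intros w w' _ _ Hw Hw'.
      eapply Rle_lt_trans; [apply (Cmod_sub_triangle _ (f (u, v)))|].
      rewrite (Cmod_sub_sym (f (u, v))).
      generalize (K w ltac:(lra)) (K w' ltac:(lra)). lra.
    - assert (Hd : 0 < (R0 - r) / 4) by lra. exists (mkposreal _ Hd). simpl.
      intros w w' Hw _ Hw1 _. exfalso.
      generalize (Cmod_le_sub (u, v) w). rewrite Cmod_sub_sym in Hw1. lra. }
  set (dl := fun u v => proj1_sig (constructive_indefinite_description _ (A u v))).
  destruct (compactness_value_2d (- r) r (- r) r dl) as [d Hd].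
  exists d. split; [apply cond_pos|]. intros [x y] z' Hz Hz' Hzz.
  assert (Hx : - r <= x <= r).
  { apply Rabs_le_between. eapply Rle_trans; [apply (re_le_Cmod (x, y))|auto]. }
  assert (Hy : - r <= y <= r).
  { apply Rabs_le_between. eapply Rle_trans; [apply (im_le_Cmod (x, y))|auto]. }
  destruct (NNPP _ (Hd x y Hx Hy)) as (u & v & _ & _ & Hu & Hv & Hle).
  revert Hu Hv Hle. unfold dl.
  destruct (constructive_indefinite_description _ (A u v)) as [del Hdel]; simpl.
  intros Hu Hv Hle. assert (P := cond_pos del).
  assert (Q : Cmod ((x, y) - (u, v)) < 2 * del).
  { eapply Rle_lt_trans; [apply Cmod_le_Re_Im|]. unfold Re, Im; simpl.
    unfold Rminus in *. lra. }
  apply Hdel; auto; [lra|].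
  eapply Rle_lt_trans; [apply (Cmod_sub_triangle _ (x, y))|].
  rewrite Cmod_sub_sym in Hzz. lra.
Qed.

Lemma Cmod_scal_le (t r : R) (z : C) : 0 <= t <= 1 -> Cmod z <= r -> Cmod (t * z) <= r.
Proof.
  intros Ht Hz. rewrite Cmod_mult, Cmod_R, Rabs_pos_eq by lra.
  generalize (Cmod_ge_0 z). nra.
Qed.

Lemma INR_ratio_bound (k N : nat) : (0 < N)%nat -> (k <= N)%nat -> 0 <= INR k / INR N <= 1.
Proof.
  intros HN Hk. assert (P := lt_0_INR _ HN). split.
  - apply Rle_div_r; auto. rewrite Rmult_0_l. apply pos_INR.
  - apply Rle_div_l; auto. rewrite Rmult_1_l. now apply le_INR.
Qed.

Lemma small_steps (r d : R) : 0 < d -> exists N, (0 < N)%nat /\ r < d * INR N.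
Proof.
  intros Hd. destruct (INR_unbounded (r / d)) as [N HN]. exists (S N). split; [lia|].
  rewrite S_INR. assert (r = d * (r / d)) by (field; lra). nra.
Qed.

Lemma Cmod_step (k N : nat) (r d : R) (z : C) :
  (0 < N)%nat -> r < d * INR N -> Cmod z <= r ->
  Cmod (RtoC (INR (S k) / INR N) * z - RtoC (INR k / INR N) * z) < d.
Proof.
  intros HN Hr Hz. assert (P := lt_0_INR _ HN).
  replace (RtoC (INR (S k) / INR N) * z - RtoC (INR k / INR N) * z)%C with (RtoC (/ INR N) * z)%C.
  - rewrite Cmod_mult, Cmod_R, Rabs_pos_eq by (left; now apply Rinv_0_lt_compat).
    apply (Rmult_lt_reg_l (INR N)); auto. rewrite <- Rmult_assoc, Rinv_r by lra. lra.
  - replace (RtoC (/ INR N)) with (RtoC (INR (S k) / INR N) - RtoC (INR k / INR N))%C; [ring|].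
    rewrite <- RtoC_minus. f_equal. rewrite S_INR. field. lra.
Qed.

(** Walking from 0 to [z] in [N] equal steps, each step changes [f] by less than 1, with [N]
    independent of [z]. *)
Lemma bounded_on_disc (f : C -> C) (R0 r : R) :
  0 < r < R0 -> (forall z, Cmod z < R0 -> ccont f z) ->
  exists B, 0 < B /\ forall z, Cmod z <= r -> Cmod (f z) <= B.
Proof.
  intros Hr Hc. destruct (uniform_continuity_disc f R0 r Hr Hc 1 Rlt_0_1) as [d [Hd K]].
  destruct (small_steps r d Hd) as [N [HN HrN]].
  assert (P := lt_0_INR _ HN). assert (P0 := Cmod_ge_0 (f 0)).
  exists (Cmod (f 0) + INR N). split; [lra|]. intros z Hz.
  assert (Q : forall k, (k <= N)%nat -> Cmod (f (RtoC (INR k / INR N) * z)%C) <= Cmod (f 0) + INR k).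
  { induction k; intros Hk.
    - simpl INR. replace (RtoC (0 / INR N) * z)%C with (RtoC 0); [lra|].
      replace (0 / INR N) with 0 by (field; lra). ring.
    - eapply Rle_trans; [apply (Cmod_le_sub _ (f (RtoC (INR k / INR N) * z)%C))|].
      specialize (IHk ltac:(lia)). rewrite S_INR at 2.
      assert (Cmod (f (RtoC (INR (S k) / INR N) * z)%C - f (RtoC (INR k / INR N) * z)%C) < 1).
      { apply K; try (apply Cmod_scal_le; auto; apply INR_ratio_bound; auto; lia).
        now apply (Cmod_step k N r). }
      lra. }
  specialize (Q N ltac:(lia)). replace (INR N / INR N) with 1 in Q by (field; lra).
  replace (1 * z)%C with z in Q by ring. exact Q.
Qed.

(* Compactness provides [N] for which all ratios [f ((k+1) z / N) / f (k z / N)]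
   have positive real part; the sum of their principal logarithms telescopes. *)
Theorem holomorphic_log (f : C -> C) (R0 r : R) (l0 : C) :
  0 < r < R0 ->
  (forall z, Cmod z < R0 -> exists k, cderiv f z k) ->
  (forall z, Cmod z < R0 -> f z <> 0) ->
  Cexp l0 = f 0 ->
  exists L : C -> C, L 0 = l0 /\ forall z, Cmod z < r ->
    Cexp (L z) = f z /\ forall k, cderiv f z k -> cderiv L z (k / f z).
Proof.
  intros Hr Hf Nf E0.
  assert (Cf : forall z, Cmod z < R0 -> ccont f z).
  { intros z Hz. destruct (Hf z Hz) as [k Hk]. now apply cderiv_ccont in Hk. }
  destruct (bounded_on_disc (fun z => / f z)%C R0 r Hr) as [B [HB KB]].
  { intros z Hz. apply ccont_inv; auto. }
  (* Since [/ B] bounds the modulus of [f] from below, an oscillation under [/ B] puts the ratio of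
     neighbouring values within 1 of 1, hence in the right half-plane. *)
  destruct (uniform_continuity_disc f R0 r Hr Cf (/ B)) as [d [Hd K]].
  { now apply Rinv_0_lt_compat. }
  destruct (small_steps r d Hd) as [N [HN HrN]].
  assert (PN := lt_0_INR _ HN).
  set (s := fun k => RtoC (INR k / INR N)).
  set (ratio := fun k z => (f (s (S k) * z) * / f (s k * z))%C).
  assert (in_disc : forall k z, (k <= N)%nat -> Cmod z <= r -> Cmod (s k * z) <= r).
  { intros k z Hk Hz. apply Cmod_scal_le; auto. now apply INR_ratio_bound. }
  assert (Hratio : forall k z, (k < N)%nat -> Cmod z <= r -> 0 < Re (ratio k z)).
  { intros k z Hk Hz. unfold ratio.
    assert (D0 := in_disc k z ltac:(lia) Hz). assert (D1 := in_disc (S k) z ltac:(lia) Hz).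
    assert (N0 : f (s k * z)%C <> 0) by (apply Nf; lra).
    assert (Q := K _ _ D1 D0 (Cmod_step k N r d z HN HrN Hz)).
    assert (Q1 := KB _ D0).
    set (a := f (s (S k) * z)%C) in *. set (b := f (s k * z)%C) in *.
    assert (A : Cmod (a * / b - 1) < 1).
    { replace (a * / b - 1)%C with ((a - b) * / b)%C by (field; auto). rewrite Cmod_mult.
      apply Rle_lt_trans with (Cmod (a - b) * B).
      - apply Rmult_le_compat_l; auto using Cmod_ge_0.
      - apply (Rmult_lt_reg_r (/ B)); [now apply Rinv_0_lt_compat|].
        rewrite Rmult_assoc, Rinv_r by lra. lra. }
    assert (A' := Rle_lt_trans _ _ _ (re_le_Cmod _) A).
    unfold Cminus in A'. rewrite re_plus, re_opp, re_RtoC in A'. apply Rabs_def2 in A'. lra. }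
  set (L := fix L (k : nat) (z : C) : C :=
    match k with O => l0 | S k => (L k z + Clog (ratio k z))%C end).
  assert (HL : forall k, (k <= N)%nat ->
     L k 0 = l0 /\ forall z, Cmod z < r -> Cexp (L k z) = f (s k * z)%C /\ ccont (L k) z).
  { induction k; intros Hk.
    - split; auto. intros z Hz. split.
      + simpl. rewrite E0. f_equal. unfold s. simpl INR.
        replace (0 / INR N) with 0 by (field; lra). ring.
      + apply ccont_const.
    - destruct (IHk ltac:(lia)) as [I0 I1]. split.
      + simpl L. rewrite I0. unfold ratio.
        rewrite !Cmult_0_r. rewrite Cinv_r by (apply Nf; rewrite Cmod_0; lra).
        unfold Clog. rewrite Cmod_1, ln_1. unfold Re, Im; simpl.
        replace (0 / 1) with 0 by field. rewrite atan_0. apply Cplus_0_r.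
      + intros z Hz. destruct (I1 z Hz) as [J1 J2].
        assert (D0 := in_disc k z ltac:(lia) ltac:(lra)).
        assert (D1 := in_disc (S k) z ltac:(lia) ltac:(lra)).
        assert (N0 : f (s k * z)%C <> 0) by (apply Nf; lra).
        assert (RR := Hratio k z ltac:(lia) ltac:(lra)).
        split.
        * simpl L. rewrite Cexp_plus, J1, Cexp_Clog by auto. unfold ratio. field. auto.
        * simpl L. apply ccont_plus; auto.
          apply ccont_comp; [|now apply ccont_Clog].
          unfold ratio. apply ccont_mult; [|apply ccont_inv; auto];
          (apply (ccont_comp f); [apply ccont_mult; [apply ccont_const|apply ccont_id]|];
           apply Cf; lra). }
  destruct (HL N ltac:(lia)) as [H0 H1]. exists (L N). split; auto.
  assert (SN : forall z, (s N * z = z)%C).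
  { intros z. unfold s. replace (INR N / INR N) with 1 by (field; lra). ring. }
  intros z Hz. split.
  - destruct (H1 z Hz) as [-> _]. now rewrite SN.
  - intros k Hk. apply (cderiv_lift _ f z k (r - Cmod z)); [lra| | |auto].
    + intros w Hw. destruct (H1 w) as [Q _]; [|now rewrite Q, SN].
      generalize (Cmod_le_sub w z). lra.
    + apply H1. auto.
Qed.

(** * Schottky's theorem *)

Definition Ccosh (z : C) : C := ((Cexp z + Cexp (- z)) / 2)%C.

Lemma RtoC_neq0 (x : R) : x <> 0 -> RtoC x <> 0.
Proof. intros H E. apply H. now apply RtoC_inj. Qed.

Lemma Ccosh_bound (z : C) : Cmod (Ccosh z) <= exp (Cmod z).
Proof.
  unfold Ccosh. rewrite Cmod_div by (apply RtoC_neq0; lra).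
  rewrite Cmod_R, Rabs_pos_eq by lra.
  assert (E : forall w : C, Cmod (Cexp w) <= exp (Cmod w)).
  { intros w. rewrite Cmod_Cexp.
    destruct (Rle_lt_or_eq_dec (Re w) (Cmod w)) as [H|H].
    - eapply Rle_trans; [apply Rle_abs|apply re_le_Cmod].
    - left. now apply exp_increasing.
    - rewrite H. lra. }
  assert (T := Cmod_triangle (Cexp z) (Cexp (- z))).
  assert (E1 := E z). assert (E2 := E (- z)%C). rewrite Cmod_opp in E2. lra.
Qed.

Lemma Ccosh_coord (x y : R) :
  Ccosh (x, y) = ((exp x + exp (- x)) / 2 * cos y, (exp x - exp (- x)) / 2 * sin y).
Proof.
  unfold Ccosh, Cexp; simpl. rewrite cos_neg, sin_neg.
  apply injective_projections; simpl; field.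
Qed.

Lemma cos_sin_multiple_PI (k : Z) :
  sin (IZR k * PI) = 0 /\ (cos (IZR k * PI) = 1 \/ cos (IZR k * PI) = -1).
Proof.
  assert (S : sin (IZR k * PI) = 0) by (apply sin_eq_0_1; now exists k).
  split; auto. generalize (sin2_cos2 (IZR k * PI)). rewrite S. unfold Rsqr. intros Q.
  assert (Q' : (cos (IZR k * PI) - 1) * (cos (IZR k * PI) + 1) = 0) by lra.
  apply Rmult_integral in Q'. destruct Q'; [left|right]; lra.
Qed.

Lemma Ccosh_i_pi_Z (k : Z) :
  Ccosh (Ci * PI * IZR k) = 1 \/ Ccosh (Ci * PI * IZR k) = (- (1))%C.
Proof.
  replace (Ci * PI * IZR k)%C with ((0, IZR k * PI) : C)
    by (apply injective_projections; simpl; ring).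
  rewrite Ccosh_coord. destruct (cos_sin_multiple_PI k) as [-> [->| ->]];
    [left|right]; rewrite Ropp_0, exp_0; apply injective_projections; simpl; field.
Qed.

(** For [a >= 0] the point [x] is the inverse hyperbolic cosine [ln (n + sqrt (n^2 - 1))] of the
    integer [n] just above [cosh a]. Since [exp 2 >= 4] and [2 * n <= 4 * exp a], it cannot exceed
    [a + 2]. *)
Lemma real_cosh_integer_near (a : R) :
  exists x n, Rabs (a - x) <= 2 /\ (exp x + exp (- x)) / 2 = IZR n.
Proof.
  assert (P : forall a, 0 <= a ->
    exists x n, Rabs (a - x) <= 2 /\ (exp x + exp (- x)) / 2 = IZR n).
  { clear a. intros a Ha.
    assert (Ea := exp_pos a). assert (Ea' := exp_pos (- a)).
    assert (E1 : exp a * exp (- a) = 1) by (rewrite <- exp_plus, Rplus_opp_r; apply exp_0).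
    assert (Ea1 : 1 <= exp a) by (generalize (exp_ineq1_le a); lra).
    assert (Ea2 : exp (- a) <= exp a) by nra.
    set (ch := (exp a + exp (- a)) / 2).
    assert (Hch : 1 <= ch) by (unfold ch; nra).
    destruct (archimed ch) as [U1 U2]. set (n := up ch) in *.
    set (s := sqrt (IZR n * IZR n - 1)).
    assert (Hs : s * s = IZR n * IZR n - 1) by (apply sqrt_sqrt; nra).
    assert (Hs0 : 0 <= s) by apply sqrt_pos.
    assert (Hsn : s <= IZR n) by nra.
    set (x := ln (IZR n + s)).
    assert (Ex : exp x = IZR n + s) by (apply exp_ln; lra).
    assert (Ex' : exp (- x) = IZR n - s).
    { apply (Rmult_eq_reg_l (exp x)); [|generalize (exp_pos x); lra].
      rewrite <- exp_plus, Rplus_opp_r, exp_0, Ex. nra. }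
    assert (E2 : 4 <= exp 2).
    { replace 2 with (1 + 1) by ring. rewrite exp_plus. generalize (exp_ineq1_le 1). nra. }
    exists x, n. split; [|rewrite Ex, Ex'; field].
    apply Rabs_le. split.
    - assert (x <= a + 2); [|lra]. apply Rnot_lt_le. intros L.
      apply exp_increasing in L. rewrite Ex, exp_plus in L. unfold ch in *. nra.
    - assert (a <= x + 2); [|lra]. apply Rnot_lt_le. intros L.
      apply exp_increasing in L. rewrite exp_plus, Ex in L. unfold ch in *. nra. }
  destruct (Rle_dec 0 a) as [H|H]; [now apply P|].
  destruct (P (- a)) as (x & n & Hx & E); [lra|].
  exists (- x), n. split.
  - rewrite <- Rabs_Ropp. replace (- (a - - x)) with (- a - x) by ring. auto.
  - rewrite Ropp_involutive, Rplus_comm. auto.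
Qed.

(** On the horizontal lines at heights [k * PI], the function is the real hyperbolic cosine up to
    sign. The constant 6 covers 2 along the line and [PI <= 4] across. *)
Lemma Ccosh_integer_net (zeta : C) :
  exists lam, Cmod (zeta - lam) <= 6 /\ exists n : Z, Ccosh lam = IZR n.
Proof.
  destruct zeta as [a b]. destruct (real_cosh_integer_near a) as (x & n & Hx & E).
  assert (P := PI_RGT_0). assert (P4 := PI_4).
  destruct (archimed (b / PI)) as [U1 U2]. set (k := up (b / PI)) in *.
  assert (Eb : b = b / PI * PI) by (field; lra).
  exists (x, IZR k * PI). split.
  - eapply Rle_trans; [apply Cmod_le_Re_Im|]. unfold Re, Im; simpl.
    unfold Rminus in Hx.
    assert (Rabs (b + - (IZR k * PI)) <= PI) by (apply Rabs_le; nra). lra.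
  - rewrite Ccosh_coord, E. destruct (cos_sin_multiple_PI k) as [-> [->| ->]].
    + exists n. apply injective_projections; simpl; ring.
    + exists (- n)%Z. rewrite opp_IZR. apply injective_projections; simpl; ring.
Qed.

(** Solving [(v + 1 / v) / 2 = w] gives [v = w + sqrt (w^2 - 1)], and [p] is a logarithm of [v].
    Omitting 1 and -1 makes the root holomorphic, and [v * (w - s) = 1] shows that [v] never
    vanishes. At 0 both [v] and [1 / v] are at most [1 + 2 * m] in modulus, which bounds the real
    part of [p 0]; the 8 covers the imaginary part. *)
Lemma cosh_lift (w : C -> C) (R0 r : R) :
  0 < r < R0 ->
  (forall z, Cmod z < R0 -> exists k, cderiv w z k) ->
  (forall z, Cmod z < R0 -> w z <> 1 /\ w z <> (- (1))%C) ->
  exists p : C -> C,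
    (forall z, Cmod z < r -> Ccosh (p z) = w z /\ exists k, cderiv p z k) /\
    Cmod (p 0) <= 2 * Cmod (w 0) + 8.
Proof.
  (* Two logarithms are taken in turn, for the root and for [v]; each one shrinks the disc, so an
     intermediate radius is inserted. *)
  intros Hr Hw Nw. set (r1 := (r + R0) / 2).
  assert (Hr1 : 0 < r1 < R0) by (unfold r1; lra).
  assert (Hr2 : 0 < r < r1) by (unfold r1; lra).
  set (f1 := fun z => (w z * w z - 1)%C).
  assert (N1 : forall z, Cmod z < R0 -> f1 z <> 0).
  { intros z Hz. destruct (Nw z Hz) as [A B]. unfold f1.
    replace (w z * w z - 1)%C with ((w z - 1) * (w z - - (1)))%C by ring.
    apply Cmult_neq_0; now apply Cminus_eq_contra. }
  assert (H1 : forall z, Cmod z < R0 -> exists k, cderiv f1 z k).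
  { intros z Hz. destruct (Hw z Hz) as [k Hk]. eexists. unfold f1.
    apply cderiv_minus; [|apply cderiv_const]. apply cderiv_mult; exact Hk. }
  destruct (Cexp_log_exists (f1 0)) as [l1 [El1 _]]; [apply N1; rewrite Cmod_0; lra|].
  destruct (holomorphic_log f1 R0 r1 l1 Hr1 H1 N1 El1) as (L1 & _ & HL1).
  assert (two : RtoC 2 <> 0) by (apply RtoC_neq0; lra).
  set (s := fun z => Cexp (/ 2 * L1 z)%C).
  assert (Hs : forall z, Cmod z < r1 -> (s z * s z = w z * w z - 1)%C).
  { intros z Hz. unfold s. rewrite <- Cexp_plus.
    replace (/ 2 * L1 z + / 2 * L1 z)%C with (L1 z) by (field; auto).
    destruct (HL1 z Hz) as [-> _]. auto. }
  set (v := fun z => (w z + s z)%C).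
  assert (Hv : forall z, Cmod z < r1 -> (v z * (w z - s z) = 1)%C).
  { intros z Hz. unfold v.
    replace ((w z + s z) * (w z - s z))%C with (w z * w z - s z * s z)%C by ring.
    rewrite Hs by auto. ring. }
  assert (Nv : forall z, Cmod z < r1 -> v z <> 0).
  { intros z Hz E. specialize (Hv z Hz). rewrite E, Cmult_0_l in Hv.
    apply RtoC_inj in Hv. lra. }
  assert (Hdv : forall z, Cmod z < r1 -> exists k, cderiv v z k).
  { intros z Hz. destruct (Hw z) as [k Hk]; [lra|]. destruct (H1 z) as [k1 Hk1]; [lra|].
    destruct (HL1 z Hz) as [_ D]. specialize (D k1 Hk1).
    eexists. unfold v, s. apply cderiv_plus; [exact Hk|].
    apply (cderiv_comp Cexp (fun z => / 2 * L1 z)%C); [|apply cderiv_Cexp].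
    apply cderiv_scal. exact D. }
  assert (Z1 : Cmod 0 < r1) by (rewrite Cmod_0; lra).
  destruct (Cexp_log_exists (v 0)) as [l2 [El2 Il2]]; [now apply Nv|].
  destruct (holomorphic_log v r1 r l2 Hr2 Hdv Nv El2) as (p & Ep & Hp).
  exists p. split.
  - intros z Hz. destruct (Hp z Hz) as [E D]. split.
    + unfold Ccosh. rewrite Cexp_opp, E.
      replace (/ v z)%C with (w z - s z)%C; [unfold v; field; auto|].
      assert (Q := Hv z ltac:(lra)). assert (Nz := Nv z ltac:(lra)).
      replace (w z - s z)%C with (/ v z * (v z * (w z - s z)))%C by (field; auto).
      rewrite Q. ring.
    + destruct (Hdv z) as [k Hk]; [lra|]. eexists. apply D. exact Hk.
  - rewrite Ep. set (m := Cmod (w 0)). assert (Hm : 0 <= m) by apply Cmod_ge_0.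
    assert (Bs : Cmod (s 0) <= m + 1).
    { assert (Q : Cmod (s 0) * Cmod (s 0) <= m * m + 1).
      { rewrite <- Cmod_mult, Hs by auto. unfold m. rewrite <- Cmod_mult.
        unfold Cminus. eapply Rle_trans; [apply Cmod_triangle|].
        rewrite Cmod_opp, Cmod_1. lra. }
      generalize (Cmod_ge_0 (s 0)). nra. }
    assert (B1 : exp (Re l2) <= 1 + 2 * m).
    { rewrite <- Cmod_Cexp, El2. unfold v. eapply Rle_trans; [apply Cmod_triangle|].
      fold m. lra. }
    assert (B2 : exp (- Re l2) <= 1 + 2 * m).
    { rewrite <- re_opp, <- Cmod_Cexp, Cexp_opp, El2.
      replace (/ v 0)%C with (w 0 + - s 0)%C.
      - eapply Rle_trans; [apply Cmod_triangle|]. rewrite Cmod_opp. fold m. lra.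
      - assert (N0 := Nv 0 Z1).
        replace (w 0 + - s 0)%C with (/ v 0 * (v 0 * (w 0 - s 0)))%C by (field; auto).
        rewrite Hv by auto. ring. }
    assert (E : forall t, exp t <= 1 + 2 * m -> t <= 2 * m).
    { intros t Ht. apply Rnot_lt_le. intros L. apply exp_increasing in L.
      generalize (exp_ineq1_le (2 * m)). lra. }
    apply E in B1. apply E in B2.
    eapply Rle_trans; [apply Cmod_le_Re_Im|].
    assert (Rabs (Re l2) <= 2 * m) by (apply Rabs_le; lra).
    generalize PI_4. lra.
Qed.

Lemma cauchy_estimate (f : C -> C) (l : C) (R0 r B : R) :
  0 < r < R0 ->
  (forall z, Cmod z < R0 -> exists k, cderiv f z k) -> cderiv f 0 l ->
  (forall z, Cmod z <= r -> Cmod (f z) <= B) ->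
  r * Cmod l <= 8 * B.
Proof.
  intros Hr Hf Hl HB.
  assert (A := borel_caratheodory f l R0 r B Hr Hf Hl).
  assert (Q := HB 0 ltac:(rewrite Cmod_0; lra)).
  assert (Q' := Rle_trans _ _ _ (re_le_Cmod _) Q). apply Rabs_le_between in Q'.
  assert (r * Cmod l <= 4 * (B - Re (f 0))); [|lra].
  apply A. intros z Hz. eapply Rle_trans; [apply Rle_abs|].
  eapply Rle_trans; [apply re_le_Cmod|]. apply HB. lra.
Qed.

Lemma ln_le_sub1 (x : R) : 0 < x -> ln x <= x - 1.
Proof. intros H. generalize (exp_ineq1_le (ln x)). rewrite exp_ln by auto. lra. Qed.

(* At a near-maximum [p] of [(R0/2 - |z|) |g' z|] the function [g] grows at most
   linearly at scale [t = (R0/2 - |p|) / 2].  As [g] omits some [lam] near [g p],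
   Borel-Caratheodory for [log (g - lam)] bounds [X = t |g' p|] by [O(log X)]. *)
Lemma bound_of_omitted_net :
  exists C0, forall (g : C -> C) (R0 : R), 0 < R0 ->
    (forall z, Cmod z < R0 -> exists k, cderiv g z k) ->
    (forall zeta, exists lam, Cmod (zeta - lam) <= 6 /\
       forall z, Cmod z < R0 -> g z <> lam) ->
    forall z, Cmod z <= R0 / 4 -> Cmod (g z - g 0) <= C0.
Proof.
  exists 160000. intros g R0 HR0 Hg Hnet.
  set (dg := fun z => epsilon (inhabits (RtoC 0)) (fun k => cderiv g z k)).
  assert (Hd : forall z, Cmod z < R0 -> cderiv g z (dg z)).
  { intros z Hz. unfold dg. apply epsilon_spec. auto. }
  clearbody dg.
  assert (Cg : forall z, Cmod z < R0 -> ccont g z).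
  { intros z Hz. eapply cderiv_ccont. auto. }
  set (rho := R0 / 2).
  destruct (bounded_on_disc g R0 (3 * R0 / 4)) as [B [HB KB]]; [lra|auto|].
  (* This bound depends on [g]; it only ensures that the supremum [m] is finite. The uniform bound
     on [m] comes later. *)
  assert (Hdg : forall p, Cmod p < rho -> (rho - Cmod p) * Cmod (dg p) <= 16 * B).
  { intros p Hp. unfold rho in Hp.
    assert (Q : R0 / 4 * Cmod (dg p) <= 8 * B).
    { apply (cauchy_estimate (fun z => g (p + z)%C) (dg p) (R0 / 2)); [lra| | |].
      - intros z Hz. exists (dg (p + z)%C). apply cderiv_translate, Hd.
        eapply Rle_lt_trans; [apply Cmod_triangle|]. lra.
      - apply cderiv_translate. rewrite Cplus_0_r. apply Hd. lra.
      - intros z Hz. apply KB. eapply Rle_trans; [apply Cmod_triangle|]. lra. }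
    generalize (Cmod_ge_0 p) (Cmod_ge_0 (dg p)). unfold rho. nra. }
  destruct (completeness (fun v => exists p, Cmod p < rho /\ v = (rho - Cmod p) * Cmod (dg p)))
    as [m [Hm1 Hm2]].
  { exists (16 * B). intros v (p & Hp & ->). auto. }
  { exists ((rho - Cmod 0) * Cmod (dg 0)), 0. split; auto. rewrite Cmod_0. unfold rho. lra. }
  assert (Hm : forall p, Cmod p < rho -> (rho - Cmod p) * Cmod (dg p) <= m)
    by (intros p Hp; apply Hm1; eauto).
  assert (Mbound : m <= 160000).
  { apply Rnot_lt_le. intros Lm.
    (* A point attaining half the supremum is used because [dg] is not known to be continuous, so
       that a maximum need not be available. *)
    assert (Hp : exists p, Cmod p < rho /\ m / 2 < (rho - Cmod p) * Cmod (dg p)).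
    { apply NNPP. intros N. assert (m <= m / 2); [|lra]. apply Hm2.
      intros v (p & Hp & ->). apply Rnot_lt_le. intros L. apply N. eauto. }
    destruct Hp as (p & Hp & Lp).
    set (A := Cmod (dg p)) in *. set (t := (rho - Cmod p) / 2).
    assert (Ht : 0 < t) by (unfold t; lra).
    assert (A0 : 0 <= A) by apply Cmod_ge_0.
    assert (tA : m / 4 < t * A) by (unfold t; lra).
    set (X := t * A) in *.
    assert (disc_p : forall z, Cmod z < t -> Cmod (p + z) < rho /\ t <= rho - Cmod (p + z)).
    { intros z Hz. generalize (Cmod_triangle p z). unfold t in *. lra. }
    assert (grow : forall z, Cmod z < t -> Cmod (g (p + z)%C - g p) <= 4 * X).
    { intros z Hz.
      assert (sub : forall s, 0 <= s <= 1 -> Cmod (RtoC s * z) < t).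
      { intros s Hs. eapply Rle_lt_trans; [apply Cmod_scal_le|]; eauto. apply Rle_refl. }
      assert (Q : Cmod (g (p + z)%C - g p) <= 4 * A * Cmod (p + z - p)).
      { apply (cderiv_mean_value g dg); intros s Hs;
          replace (p + s * (p + z - p))%C with (p + s * z)%C by ring;
          destruct (disc_p _ (sub s Hs)) as [D1 D2].
        - apply Hd. unfold rho in *. lra.
        - specialize (Hm _ D1). assert (Z := Cmod_ge_0 (dg (p + s * z)%C)).
          apply (Rmult_le_reg_l t); auto. unfold X in *. nra. }
      replace (p + z - p)%C with z in Q by ring. unfold X.
      generalize (Cmod_ge_0 z). nra. }
    destruct (Hnet (g p)) as (lam & Hlam & Olam).
    set (G := fun z => (g (p + z)%C - lam)%C).
    assert (NG : forall z, Cmod z < t -> G z <> 0).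
    { intros z Hz. apply Cminus_eq_contra, Olam. destruct (disc_p z Hz). unfold rho in *. lra. }
    assert (DG : forall z, Cmod z < t -> cderiv G z (dg (p + z)%C)).
    { intros z Hz. unfold G. replace (dg (p + z)%C) with (dg (p + z) - 0)%C by ring.
      apply cderiv_minus; [|apply cderiv_const]. apply cderiv_translate, Hd.
      destruct (disc_p z Hz). unfold rho in *. lra. }
    assert (Z0 : Cmod 0 < t) by (rewrite Cmod_0; lra).
    destruct (Cexp_log_exists (G 0)) as [l0 [El0 _]]; [now apply NG|].
    destruct (holomorphic_log G t (3 * t / 4) l0) as (L & EL & HL); auto; [lra| |].
    { intros z Hz. eexists. now apply DG. }
    assert (ReL : forall z, Cmod z < 3 * t / 4 -> Re (L z) = ln (Cmod (G z))).
    { intros z Hz. destruct (HL z Hz) as [<- _]. rewrite Cmod_Cexp, ln_exp. auto. }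
    assert (G0 : G 0 = (g p - lam)%C) by (unfold G; now rewrite Cplus_0_r).
    assert (BC := borel_caratheodory L (dg p / G 0) (3 * t / 4) (t / 2) (ln (6 + 4 * X))).
    assert (BC' : t / 2 * Cmod (dg p / G 0) <= 4 * (ln (6 + 4 * X) - Re (L 0))).
    { apply BC; [lra| | |].
      - intros z Hz. eexists. apply (HL z Hz). apply DG. lra.
      - apply (HL 0); [rewrite Cmod_0; lra|].
        assert (Q := DG 0 Z0). now rewrite Cplus_0_r in Q.
      - intros z Hz. rewrite ReL by lra.
        assert (Pz := proj1 (Cmod_gt_0 _) (NG z ltac:(lra))).
        assert (Cmod (G z) <= 6 + 4 * X).
        { unfold G. eapply Rle_trans; [apply (Cmod_sub_triangle _ (g p))|].
          generalize (grow z ltac:(lra)). lra. }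
        apply ln_le; auto. }
    clear BC. rewrite ReL in BC' by (rewrite Cmod_0; lra).
    rewrite Cmod_div in BC' by now apply NG.
    assert (Pd := proj1 (Cmod_gt_0 _) (NG 0 Z0)).
    assert (Hdel : Cmod (G 0) <= 6) by now rewrite G0.
    set (del := Cmod (G 0)) in *. fold A in BC'.
    assert (B1 : X <= 8 * del * (ln (6 + 4 * X) - ln del)).
    { apply (Rmult_le_reg_r (/ del)); [now apply Rinv_0_lt_compat|].
      replace (8 * del * (ln (6 + 4 * X) - ln del) * / del)
        with (2 * (4 * (ln (6 + 4 * X) - ln del))) by (field; lra).
      replace (X * / del) with (2 * (t / 2 * (A / del))) by (unfold X; field; lra). lra. }
    (* The value [g p] may be arbitrarily close to [lam], but the diverging [- ln del] carries the
       factor [del] from the logarithmic derivative. *)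
    assert (B2 : - del * ln del <= 1).
    { assert (Q := ln_le_sub1 (/ del) (Rinv_0_lt_compat _ Pd)). rewrite ln_Rinv in Q by auto.
      assert (del * (- ln del) <= del * (/ del - 1)) by (apply Rmult_le_compat_l; lra).
      replace (del * (/ del - 1)) with (1 - del) in H by (field; lra). lra. }
    set (Y := sqrt (6 + 4 * X)).
    assert (HY : Y * Y = 6 + 4 * X) by (apply sqrt_sqrt; lra).
    assert (HY0 : 0 < Y) by (apply sqrt_lt_R0; lra).
    assert (B3 : ln (6 + 4 * X) <= 2 * Y).
    { rewrite <- HY, ln_mult by auto. generalize (ln_le_sub1 Y HY0). lra. }
    assert (B4 : del * ln (6 + 4 * X) <= 12 * Y).
    { apply Rle_trans with (del * (2 * Y)); [apply Rmult_le_compat_l; lra|]. nra. }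
    (* With [Y * Y = 6 + 4 * X] this forces [Y < 385], whence [X < 40000]. As [m / 4 < X], this
       contradicts [m > 160000]. *)
    assert (X <= 96 * Y + 8) by lra.
    assert (Y < 385) by nra. nra. }
  intros z Hz.
  assert (Q : Cmod (g z - g 0) <= m / (R0 / 4) * Cmod (z - 0)).
  { apply (cderiv_mean_value g dg); intros s Hs; replace (0 + s * (z - 0))%C with (s * z)%C by ring;
      assert (S := Cmod_scal_le s (R0 / 4) z Hs Hz).
    - apply Hd. lra.
    - apply Rle_div_r; [lra|]. specialize (Hm (s * z)%C). unfold rho in Hm.
      generalize (Cmod_ge_0 (dg (s * z)%C)). intros.
      specialize (Hm ltac:(lra)). nra. }
  replace (z - 0)%C with z in Q by ring.
  assert (M0 : 0 <= m).
  { eapply Rle_trans; [|apply (Hm 0); rewrite Cmod_0; unfold rho; lra].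
    apply Rmult_le_pos; [rewrite Cmod_0; unfold rho; lra|apply Cmod_ge_0]. }
  assert (m / (R0 / 4) * Cmod z <= m / (R0 / 4) * (R0 / 4)).
  { apply Rmult_le_compat_l; auto. apply Rle_div_r; lra. }
  replace (m / (R0 / 4) * (R0 / 4)) with m in H by (field; lra). lra.
Qed.

(* Writing [2 f - 1 = cosh p] and [p / (i PI) = cosh q], the function [p] omits
   [i PI Z], so [q] omits the relatively dense set of points where [cosh] is an integer. *)
Theorem schottky :
  forall M, exists S, forall (f : C -> C) (R0 : R), 0 < R0 ->
    (forall z, Cmod z < R0 -> exists k, cderiv f z k) ->
    (forall z, Cmod z < R0 -> f z <> 0 /\ f z <> 1) ->
    Cmod (f 0) <= M ->
    forall z, Cmod z <= R0 / 16 -> Cmod (f z) <= S.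
Proof.
  intros M. destruct bound_of_omitted_net as [C0 HC0].
  (* The nested expression bounds [w 0], then [h 0], then [q 0], each lift contributing [2 * _ + 8];
     [C0] accounts for the way from 0 to [z]. *)
  set (Q := C0 + (2 * (2 * (2 * M + 1) + 8) + 8)).
  exists ((1 + exp (4 * exp Q)) / 2).
  intros f R0 HR0 Hf Of HM z Hz.
  assert (two : RtoC 2 <> 0) by (apply RtoC_neq0; lra).
  set (w := fun z => (2 * f z - 1)%C).
  (* The lifts leave the radii [R0 / 2] and [R0 / 4], and the bound for omitted nets holds on a
     quarter of the latter: hence [R0 / 16]. *)
  destruct (cosh_lift w R0 (R0 / 2)) as (p & Hp & Bp); [lra| | |].
  { intros u Hu. destruct (Hf u Hu) as [k Hk]. eexists. unfold w.
    apply cderiv_minus; [|apply cderiv_const]. apply cderiv_scal. exact Hk. }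
  { intros u Hu. destruct (Of u Hu) as [O0 O1]. unfold w. split; intros E.
    - apply O1. replace (f u) with ((2 * f u - 1 + 1) / 2)%C by (field; auto).
      rewrite E. field; auto.
    - apply O0. replace (f u) with ((2 * f u - 1 + 1) / 2)%C by (field; auto).
      rewrite E. field; auto. }
  assert (PI3 : 3 < PI) by (generalize PI2_3_2; lra).
  assert (NPI : RtoC PI <> 0) by (apply RtoC_neq0; lra).
  assert (Nc : (Ci * PI)%C <> 0) by (apply Cmult_neq_0; auto using Ci_nz).
  assert (Mc : Cmod (Ci * PI) = PI) by (rewrite Cmod_mult, Cmod_Ci, Cmod_R, Rabs_pos_eq; lra).
  set (h := fun z => (/ (Ci * PI) * p z)%C).
  assert (Ph : forall u, (p u = Ci * PI * h u)%C).
  { intros u. unfold h. field; auto using Ci_nz. }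
  assert (Oh : forall u, Cmod u < R0 / 2 -> forall n : Z, h u <> IZR n).
  { intros u Hu n E. destruct (Hp u Hu) as [W _]. rewrite Ph, E in W.
    destruct (Of u ltac:(lra)) as [O0 O1]. unfold w in W.
    destruct (Ccosh_i_pi_Z n) as [F|F]; rewrite F in W.
    - apply O1. replace (f u) with ((2 * f u - 1 + 1) / 2)%C by (field; auto).
      rewrite <- W. field; auto.
    - apply O0. replace (f u) with ((2 * f u - 1 + 1) / 2)%C by (field; auto).
      rewrite <- W. field; auto. }
  assert (Mh : forall u, Cmod (p u) = PI * Cmod (h u)).
  { intros u. rewrite Ph, Cmod_mult, Mc. auto. }
  (* The second lift is possible because [h] omits the integers 1 and -1; the other omitted integers
     pass to [q] as an omitted net. *)
  destruct (cosh_lift h (R0 / 2) (R0 / 4)) as (q & Hq & Bq); [lra| | |].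
  { intros u Hu. destruct (Hp u Hu) as [_ [k Hk]]. eexists. unfold h. apply cderiv_scal. exact Hk. }
  { intros u Hu. split; [apply (Oh u Hu 1%Z)|]. rewrite <- RtoC_opp. apply (Oh u Hu (-1)%Z). }
  assert (Dq : Cmod (q z - q 0) <= C0).
  { apply (HC0 q (R0 / 4)); [lra| | |lra].
    - intros u Hu. apply (Hq u Hu).
    - intros zeta. destruct (Ccosh_integer_net zeta) as (lam & Hlam & n & En).
      exists lam. split; auto. intros u Hu E. destruct (Hq u Hu) as [W _].
      rewrite E, En in W. apply (Oh u ltac:(lra) n). auto. }
  assert (Bw0 : Cmod (w 0) <= 2 * M + 1).
  { unfold w, Cminus. eapply Rle_trans; [apply Cmod_triangle|].
    rewrite Cmod_mult, Cmod_opp, Cmod_1, Cmod_R, Rabs_pos_eq by lra. lra. }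
  assert (Bh0 : Cmod (h 0) <= 2 * (2 * M + 1) + 8).
  { assert (E := Mh 0). assert (Z := Cmod_ge_0 (h 0)). nra. }
  assert (Bq_z : Cmod (q z) <= Q).
  { eapply Rle_trans; [apply (Cmod_le_sub _ (q 0))|]. unfold Q. lra. }
  assert (mono : forall x y, x <= y -> exp x <= exp y).
  { intros x y [L| ->]; [left; now apply exp_increasing|lra]. }
  assert (Bh : Cmod (h z) <= exp Q).
  { destruct (Hq z ltac:(lra)) as [<- _]. eapply Rle_trans; [apply Ccosh_bound|]. auto. }
  assert (Bw : Cmod (w z) <= exp (4 * exp Q)).
  { destruct (Hp z ltac:(lra)) as [<- _]. eapply Rle_trans; [apply Ccosh_bound|].
    apply mono. rewrite Mh. generalize PI_4 (Cmod_ge_0 (h z)). nra. }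
  replace (f z) with ((w z + 1) / 2)%C by (unfold w; field; auto).
  rewrite Cmod_div, Cmod_R, Rabs_pos_eq by (auto; lra).
  generalize (Cmod_triangle (w z) 1). rewrite Cmod_1. lra.
Qed.

(** * Picard's theorem *)

(** An omitted value has an empty, hence bounded, fibre, so one notion covers omitted values and
    those attained only near the origin. *)
Definition bounded_fibre (f : C -> C) (y : C) : Prop :=
  exists rho, forall z, f z = y -> Cmod z <= rho.

Lemma not_pole_at_infinity (f : C -> C) :
  ~ pole (fun z => f (/ z)%C) 0 ->
  exists M, forall rho, exists z, rho < Cmod z /\ Cmod (f z) <= M.
Proof.
  intros NP. apply NNPP. intros N. apply NP. intros P [M HM].
  assert (A : exists rho, forall z, rho < Cmod z -> M < Cmod (f z)).
  { apply NNPP. intros N'. apply N. exists M. intros rho. apply NNPP. intros N2.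
    apply N'. exists rho. intros z Hz. apply Rnot_le_lt. intros L. apply N2. eauto. }
  destruct A as [rho Hrho].
  (* Neighbourhoods in [pole] are those of the product structure, that is squares; the factor 2
     absorbs the passage from coordinates to the modulus. *)
  set (e := / (2 * (Rabs rho + 1))).
  assert (Hr := Rabs_pos rho). assert (He : 0 < e) by (apply Rinv_0_lt_compat; lra).
  exists (mkposreal e He). intros y Hy Ny. apply HM, Hrho.
  destruct y as [y1 y2]. destruct Hy as [Hy1 Hy2].
  change (Rabs (y1 - 0) < e) in Hy1. change (Rabs (y2 - 0) < e) in Hy2.
  assert (My : Cmod (y1, y2) < / (Rabs rho + 1)).
  { replace (/ (Rabs rho + 1)) with (2 * e) by (unfold e; field; lra).
    eapply Rle_lt_trans; [apply Cmod_le_Re_Im|]. unfold Re, Im; simpl.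
    rewrite Rminus_0_r in *. lra. }
  rewrite Cmod_inv by auto. assert (P0 := proj1 (Cmod_gt_0 _) Ny).
  apply Rle_lt_trans with (Rabs rho + 1); [generalize (Rle_abs rho); lra|].
  rewrite <- (Rinv_inv (Rabs rho + 1)). apply Rinv_lt_contravar; auto.
  apply Rmult_lt_0_compat; auto. apply Rinv_0_lt_compat. lra.
Qed.

Lemma Re_le_of_exp (z w : C) (c : R) :
  Cmod (Cexp z) <= exp c * Cmod (Cexp w) -> Re z <= c + Re w.
Proof.
  rewrite !Cmod_Cexp, <- exp_plus. intros H. apply Rnot_lt_le. intros L.
  apply exp_increasing in L. lra.
Qed.

(* Pulled back by [Cexp], the neighbourhood of a circle where [f] takes a
   moderate value is covered by a single disc on which [f o Cexp] omits 0 and 1. *)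
Lemma bounded_annuli (f : C -> C) (M rho : R) :
  (forall z, exists k, cderiv f z k) ->
  (forall rho', exists z, rho' < Cmod z /\ Cmod (f z) <= M) ->
  (forall z, rho < Cmod z -> f z <> 0 /\ f z <> 1) ->
  exists S, forall rho', exists r, rho' < r /\
    forall z, r / 2 <= Cmod z <= 3 * r / 2 -> Cmod (f z) <= S.
Proof.
  intros Hf HM Of. destruct (schottky M) as [S HS]. exists S. intros rho'.
  (* In the logarithmic coordinate the annulus lies within [1 + 4 * PI <= 17] of the base point,
     below 300 / 16. Over the disc of radius 300 the modulus of [Cexp] falls by a factor of at most
     [exp 300], so it stays beyond [rho]. *)
  set (big := Rmax rho' (Rabs rho * exp 300)).
  destruct (HM big) as (z0 & Hz0 & Mz0). set (r := Cmod z0) in *.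
  assert (B1 : rho' <= big) by apply Rmax_l.
  assert (B2 : Rabs rho * exp 300 <= big) by apply Rmax_r.
  assert (Hrho := Rabs_pos rho). assert (He := exp_pos 300).
  assert (Hr : 0 < r) by (assert (0 <= Rabs rho * exp 300) by (apply Rmult_le_pos; lra); lra).
  exists r. split; [lra|]. intros z Hz.
  destruct (Cexp_log_exists z0) as (w0 & E0 & I0); [apply Cmod_gt_0; exact Hr|].
  destruct (Cexp_log_exists z) as (w & E & I); [apply Cmod_gt_0; lra|].
  assert (e2 : 2 <= exp 1) by (generalize (exp_ineq1_le 1); lra).
  replace z with (Cexp (w0 + (w - w0))%C) by (rewrite <- E; f_equal; ring).
  apply (HS (fun u => f (Cexp (w0 + u)%C)) 300); [lra| | | |].
  - intros u _. destruct (Hf (Cexp (w0 + u)%C)) as [k Hk].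
    eexists. apply (cderiv_comp f (fun u => Cexp (w0 + u)%C)); [|exact Hk].
    apply cderiv_translate, cderiv_Cexp.
  - intros u Hu. apply Of.
    assert (Q : r <= exp 300 * Cmod (Cexp (w0 + u))).
    { unfold r. rewrite <- E0, !Cmod_Cexp, <- exp_plus.
      assert (L : Re w0 <= 300 + Re (w0 + u)).
      { rewrite re_plus. assert (X := re_le_Cmod u). apply Rabs_le_between in X. lra. }
      destruct L as [L| <-]; [left; now apply exp_increasing|lra]. }
    apply Rle_lt_trans with (Rabs rho); [apply Rle_abs|].
    apply (Rmult_lt_reg_r (exp 300)); auto. lra.
  - rewrite Cplus_0_r, E0. exact Mz0.
  - assert (L1 : Re w <= 1 + Re w0) by (apply Re_le_of_exp; rewrite E, E0; fold r; nra).
    assert (L2 : Re w0 <= 1 + Re w) by (apply Re_le_of_exp; rewrite E, E0; fold r; nra).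
    eapply Rle_trans; [apply Cmod_le_Re_Im|]. unfold Cminus.
    rewrite re_plus, im_plus, re_opp, im_opp.
    assert (Rabs (Re w + - Re w0) <= 1) by (apply Rabs_le; lra).
    assert (X := Rabs_triang (Im w) (- Im w0)). rewrite Rabs_Ropp in X.
    generalize PI_4. lra.
Qed.

(** Borel-Caratheodory needs a bound on a single circle about [u]. Once [r > 2 * Cmod u], the circle
    of radius [r] about [u] lies in the annulus about 0, and [r * Cmod l] stays bounded for
    arbitrarily large [r]. *)
Lemma liouville_annuli (f : C -> C) (S : R) :
  (forall z, exists k, cderiv f z k) ->
  (forall rho, exists r, rho < r /\
     forall z, r / 2 <= Cmod z <= 3 * r / 2 -> Cmod (f z) <= S) ->
  forall z, f z = f 0.
Proof.
  intros Hf HS.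
  assert (D0 : forall u, cderiv f u 0).
  { intros u. destruct (Hf u) as [l Hl].
    destruct (Ceq_dec l 0) as [->|N]; auto. exfalso.
    assert (Pl := proj1 (Cmod_gt_0 _) N).
    set (K := 4 * (S - Re (f u))).
    destruct (HS (Rmax (2 * Cmod u) (Rabs K / Cmod l))) as (r & Hr & Br).
    assert (H1 := Rle_lt_trans _ _ _ (Rmax_l _ _) Hr).
    assert (H2 := Rle_lt_trans _ _ _ (Rmax_r _ _) Hr).
    assert (U := Cmod_ge_0 u).
    assert (Q : r * Cmod l <= K).
    { unfold K. replace (f u) with ((fun z => f (u + z)%C) 0) by (simpl; f_equal; ring).
      apply (borel_caratheodory (fun z => f (u + z)%C) l (2 * r)); [lra| | |].
      - intros z _. destruct (Hf (u + z)%C) as [k Hk]. exists k. now apply cderiv_translate.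
      - apply cderiv_translate. now rewrite Cplus_0_r.
      - intros z Hz. eapply Rle_trans; [apply Rle_abs|].
        eapply Rle_trans; [apply re_le_Cmod|]. apply Br.
        assert (T1 := Cmod_triangle u z). assert (T2 := Cmod_le_sub z (u + z)).
        replace (z - (u + z))%C with (- u)%C in T2 by ring. rewrite Cmod_opp in T2. lra. }
    apply Rlt_div_l in H2; auto. generalize (Rle_abs K). lra. }
  intros z. apply Ceq_minus, Cmod_eq_0, Rle_antisym; [|apply Cmod_ge_0].
  eapply Rle_trans; [|right; apply (Rmult_0_l (Cmod (z - 0)))].
  apply (cderiv_mean_value f (fun _ => RtoC 0)); intros s _; [apply D0|rewrite Cmod_0; lra].
Qed.

Theorem picard (f : C -> C) (a b : C) :
  (forall z, exists k, cderiv f z k) ->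
  ~ (exists c, forall z, f z = c) ->
  (exists M, forall rho, exists z, rho < Cmod z /\ Cmod (f z) <= M) ->
  bounded_fibre f a -> bounded_fibre f b -> a = b.
Proof.
  intros Hf Nc [M HM] [ra Ha] [rb Hb]. apply NNPP. intros N.
  assert (Nba : (b - a)%C <> 0) by (apply Cminus_eq_contra; auto).
  assert (Pba := proj1 (Cmod_gt_0 _) Nba).
  set (F := fun z => (/ (b - a) * (f z - a))%C).
  assert (HF : forall z, f z = (a + (b - a) * F z)%C) by (intros z; unfold F; field; auto).
  assert (DF : forall z, exists k, cderiv F z k).
  { intros z. destruct (Hf z) as [k Hk]. eexists. unfold F. apply cderiv_scal.
    apply cderiv_minus; [exact Hk|apply cderiv_const]. }
  destruct (bounded_annuli F (/ Cmod (b - a) * (M + Cmod a)) (Rmax ra rb)) as [S HS]; auto.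
  - intros rho. destruct (HM rho) as (z & Hz & Mz). exists z. split; auto.
    unfold F. rewrite Cmod_mult, Cmod_inv by auto. apply Rmult_le_compat_l.
    + left. now apply Rinv_0_lt_compat.
    + unfold Cminus. eapply Rle_trans; [apply Cmod_triangle|]. rewrite Cmod_opp. lra.
  - intros z Hz. assert (H1 := Rle_lt_trans _ _ _ (Rmax_l _ _) Hz).
    assert (H2 := Rle_lt_trans _ _ _ (Rmax_r _ _) Hz). split; intros E.
    + specialize (Ha z). rewrite HF, E in Ha. specialize (Ha ltac:(ring)). lra.
    + specialize (Hb z). rewrite HF, E in Hb. specialize (Hb ltac:(ring)). lra.
  - apply Nc. exists (f 0). intros z. rewrite (HF z), (HF 0).
    now rewrite (liouville_annuli F S DF HS z).
Qed.

(** * Nagata dimension *)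

Lemma dist_comm (z w : C) : dist z w = dist w z.
Proof. apply Cmod_sub_sym. Qed.

Lemma dist_triangle (a b c : C) : dist a c <= dist a b + dist b c.
Proof. apply Cmod_sub_triangle. Qed.

Lemma dist_diag (z : C) : dist z z = 0.
Proof. apply Cmod_sub_diag. Qed.

Lemma diam_le (A : Ensemble C) (s : R) :
  Rbar_le (diam A) s <-> forall z w, A z -> A w -> dist z w <= s.
Proof.
  unfold diam. set (E := fun r => _). destruct (Lub_Rbar_correct E) as [H1 H2]. split.
  - intros H z w Hz Hw. assert (Q := H1 (dist z w) ltac:(exists z, w; auto)).
    exact (Rbar_le_trans _ _ _ Q H).
  - intros H. apply H2. intros x (z & w & Hz & Hw & ->). simpl. auto.
Qed.

(** The covering property free of infima; [m] stands for the dimension plus one. *)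
Definition admissible (X : Ensemble C) (m : nat) : Prop :=
  exists c, 0 < c /\ forall s, 0 < s ->
    exists B, covering X B /\ bounded_family (c * s) B /\
      forall A, Included C A X -> Rbar_le (diam A) s -> meets_at_most A B m.

(** The infimum is over integers: if no qualifying [n] is at most [m], then [m + 1] is a lower
    bound. *)
Lemma multiplicity_le (X : Ensemble C) (s : R) (B : family) (m : Z) :
  Rbar_le (multiplicity X s B) (IZR m) <->
  exists n : nat, (Z.of_nat n <= m)%Z /\
    forall A, Included C A X -> Rbar_le (diam A) s -> meets_at_most A B n.
Proof.
  unfold multiplicity. set (E := fun x => _). destruct (Glb_Rbar_correct E) as [H1 H2]. split.
  - intros H. apply NNPP. intros N.
    assert (Q : Rbar_le (IZR (m + 1)) (Glb_Rbar E)).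
    { apply H2. intros x (n & -> & Hn). simpl. rewrite INR_IZR_INZ. apply IZR_le.
      apply Z.lt_pred_le. rewrite <- Z.sub_1_r. replace (m + 1 - 1)%Z with m by ring.
      apply Z.nle_gt. intros L. apply N. eauto. }
    assert (Q' := Rbar_le_trans _ _ _ Q H). simpl in Q'. apply le_IZR in Q'. lia.
  - intros (n & L & Hn). apply Rbar_le_trans with (INR n).
    + apply H1. exists n. auto.
    + simpl. rewrite INR_IZR_INZ. now apply IZR_le.
Qed.

Definition dim_at_most (X : Ensemble C) (n : Z) : Prop :=
  exists c : R, 0 < c /\ forall s : R, 0 < s ->
    exists B : family, covering X B /\ bounded_family (c * s) B /\
      Rbar_le (multiplicity X s B) (IZR (n + 1)).

(** A point of [X] forms a set of diameter 0 that meets a member of every covering. This excludes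
    [n < 0], the range in which the empty set differs. *)
Lemma dim_at_most_admissible (X : Ensemble C) (n : Z) :
  Inhabited C X -> dim_at_most X n <-> (0 <= n)%Z /\ admissible X (Z.to_nat (n + 1)).
Proof.
  intros [x Hx]. split.
  - intros (c & Hc & H). split.
    + destruct (H 1 Rlt_0_1) as (B & [_ HB] & _ & HM).
      apply multiplicity_le in HM. destruct HM as (k & Lk & Hk).
      destruct (HB x Hx) as (b & Hb & Hbx).
      assert (length (b :: nil) <= k)%nat; [|simpl in *; lia].
      apply (Hk (Singleton C x)).
      * intros z Hz. destruct Hz. auto.
      * apply diam_le. intros z w Hz Hw. destruct Hz, Hw. rewrite dist_diag. lra.
      * constructor; [intros []|constructor].
      * intros b' [<-|[]]. split; auto. exists x. split; auto. constructor.
    + exists c. split; auto. intros s Hs. destruct (H s Hs) as (B & H1 & H2 & HM).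
      exists B. repeat split; auto; try apply H1.
      apply multiplicity_le in HM. destruct HM as (k & Lk & Hk).
      intros A HA HD l Hl Hm. specialize (Hk A HA HD l Hl Hm). lia.
  - intros [Hn (c & Hc & H)]. exists c. split; auto. intros s Hs.
    destruct (H s Hs) as (B & H1 & H2 & HM). exists B. split; [|split]; auto.
    apply multiplicity_le. exists (Z.to_nat (n + 1)). split; [lia|auto].
Qed.

Lemma nagata_dim_le (X Y : Ensemble C) :
  Inhabited C X -> Inhabited C Y ->
  (forall m, (1 <= m)%nat -> admissible Y m -> admissible X m) ->
  Rbar_le (nagata_dim X) (nagata_dim Y).
Proof.
  intros IX IY H. unfold nagata_dim.
  set (EX := fun x => _). set (EY := fun x => exists n : Z, x = IZR n /\ _).
  destruct (Glb_Rbar_correct EX) as [H1 _]. destruct (Glb_Rbar_correct EY) as [_ H2].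
  apply H2. intros x (n & -> & Hn). apply H1. exists n. split; auto.
  apply (dim_at_most_admissible X n IX).
  apply (dim_at_most_admissible Y n IY) in Hn. destruct Hn as [Hn A].
  split; auto. apply H; auto. lia.
Qed.

Lemma nagata_dim_0 (X : Ensemble C) :
  Inhabited C X -> admissible X 1 -> nagata_dim X = Finite 0.
Proof.
  intros IX A. apply is_glb_Rbar_unique. split.
  - intros x (n & -> & Hn). apply (dim_at_most_admissible X n IX) in Hn.
    simpl. apply IZR_le. tauto.
  - intros b Hb. apply (Hb 0). exists 0%Z. split; auto.
    apply (dim_at_most_admissible X 0 IX). split; [lia|exact A].
Qed.

(** Members of the covering are replaced by their [t]-neighbourhoods in [X]. If [A] meets such a
    neighbourhood, the [t]-neighbourhood of [A] in [Y], of diameter at most [s + 2 * t], meets the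
    original member. *)
Lemma thicken_cover (X Y : Ensemble C) (B : family) (s t D : R) (m : nat) :
  (forall x, X x -> exists y, Y y /\ dist x y <= t) ->
  covering Y B -> bounded_family D B ->
  (forall A, Included C A Y -> Rbar_le (diam A) (s + 2 * t) -> meets_at_most A B m) ->
  exists B', covering X B' /\ bounded_family (D + 2 * t) B' /\
    forall A, Included C A X -> Rbar_le (diam A) s -> meets_at_most A B' m.
Proof.
  intros near [HB1 HB2] HD HM.
  set (thick := fun b : Ensemble C => (fun x => X x /\ exists y, b y /\ dist x y <= t) : Ensemble C).
  exists (fun b' => exists b, B b /\ b' = thick b). split; [split|split].
  - intros b' (b & _ & ->) x Hx. apply Hx.
  - intros x Hx. destruct (near x Hx) as (y & Hy & Hxy). destruct (HB2 y Hy) as (b & Hb & Hby).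
    exists (thick b). split; [eauto|]. split; auto. eauto.
  - intros b' (b & Hb & ->). apply diam_le. intros x x' (_ & y & Hy & Hxy) (_ & y' & Hy' & Hxy').
    assert (Q := proj1 (diam_le b D) (HD b Hb) y y' Hy Hy').
    generalize (dist_triangle x y x') (dist_triangle y y' x'). rewrite (dist_comm y' x'). lra.
  - intros A HA HdA l Hl Hm.
    (* Different members may have the same thickening; choosing one original for each gives an
       injection into [B]. *)
    set (g := fun b' => epsilon (inhabits b') (fun b => B b /\ b' = thick b)).
    assert (Hg : forall b', List.In b' l -> B (g b') /\ b' = thick (g b')).
    { intros b' Hb'. unfold g. apply epsilon_spec. apply (Hm b' Hb'). }
    rewrite <- (length_map g l).
    set (A' := (fun y => Y y /\ exists x, A x /\ dist x y <= t) : Ensemble C).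
    apply (HM A').
    + intros y Hy. apply Hy.
    + apply diam_le. intros y y' (_ & x & Hx & Hxy) (_ & x' & Hx' & Hxy').
      assert (Q := proj1 (diam_le A s) HdA x x' Hx Hx').
      generalize (dist_triangle y x y') (dist_triangle x x' y'). rewrite (dist_comm y x). lra.
    + apply NoDup_map_NoDup_ForallPairs; auto.
      intros b1 b2 Hb1 Hb2 E. destruct (Hg b1 Hb1) as [_ ->], (Hg b2 Hb2) as [_ ->].
      now rewrite E.
    + intros b Hb. apply in_map_iff in Hb. destruct Hb as (b' & <- & Hb').
      destruct (Hg b' Hb') as [G1 G2]. split; auto.
      destruct (Hm b' Hb') as [_ [x Hx]]. destruct Hx as [x HxA Hxb].
      rewrite G2 in Hxb. destruct Hxb as (_ & y & Hy & Hxy).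
      exists y. split; auto. split; [|eauto]. now apply (HB1 _ G1).
Qed.

Lemma admissible_closure (X Y : Ensemble C) (m : nat) :
  Included C X (closure Y) -> admissible Y m -> admissible X m.
Proof.
  intros HXY (c & Hc & H). exists (c * 3 + 2). split; [lra|]. intros s Hs.
  destruct (H (s + 2 * s)) as (B & H1 & H2 & H3); [lra|].
  destruct (thicken_cover X Y B s s (c * (s + 2 * s)) m) as (B' & G1 & G2 & G3); auto.
  - intros x Hx. destruct (HXY x Hx s Hs) as (y & Hy & L). exists y. split; auto. lra.
  - exists B'. repeat split; auto; try apply G1.
    replace ((c * 3 + 2) * s) with (c * (s + 2 * s) + 2 * s) by ring. exact G2.
Qed.

Lemma closure_incl (X : Ensemble C) : Included C X (closure X).
Proof. intros x Hx e He. exists x. split; auto. now rewrite dist_diag. Qed.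

Lemma admissible_singleton (e : C) : admissible (Singleton C e) 1.
Proof.
  exists 1. split; [lra|]. intros s Hs. exists (fun b => b = Singleton C e).
  split; [split|split].
  - intros b ->. intros x Hx. exact Hx.
  - intros z Hz. eauto.
  - intros b ->. apply diam_le. intros z w Hz Hw. destruct Hz, Hw. rewrite dist_diag. lra.
  - intros A _ _ l Hl Hm.
    apply (NoDup_incl_length (l' := Singleton C e :: nil) Hl).
    intros b Hb. left. symmetry. apply (Hm b Hb).
Qed.

(** The points of [I] enter the covering as singletons. A set of diameter at most [s] containing one
    of them contains nothing else and meets one member only, which is where [1 <= m] enters. *)
Lemma add_isolated_points (X Z I : Ensemble C) (B : family) (s D : R) (m : nat) :
  (forall x, X x <-> Z x \/ I x) -> (forall z, I z -> ~ Z z) ->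
  (forall z x, I z -> X x -> x <> z -> s < dist x z) ->
  (1 <= m)%nat -> 0 <= D -> covering Z B -> bounded_family D B ->
  (forall A, Included C A Z -> Rbar_le (diam A) s -> meets_at_most A B m) ->
  exists B', covering X B' /\ bounded_family D B' /\
    forall A, Included C A X -> Rbar_le (diam A) s -> meets_at_most A B' m.
Proof.
  intros HX HIZ Hiso Hm HD [HB1 HB2] HBD HM.
  exists (fun b => B b \/ exists z, I z /\ b = Singleton C z). split; [split|split].
  - intros b [Hb|(z & Hz & ->)] x Hx; apply HX.
    + left. now apply (HB1 b).
    + destruct Hx. auto.
  - intros x Hx. apply HX in Hx. destruct Hx as [Hx|Hx].
    + destruct (HB2 x Hx) as (b & Hb & Hbx). eauto.
    + exists (Singleton C x). split; [eauto|constructor].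
  - intros b [Hb|(z & Hz & ->)]; [auto|]. apply diam_le.
    intros x y Hx Hy. destruct Hx, Hy. rewrite dist_diag. auto.
  - intros A HA HdA l Hl Hml. assert (Q := proj1 (diam_le A s) HdA).
    destruct (classic (exists z, A z /\ I z)) as [(z & Az & Iz)|NI].
    + assert (only : forall x, A x -> x = z).
      { intros x Ax. apply NNPP. intros N. specialize (Hiso z x Iz (HA x Ax) N).
        specialize (Q x z Ax Az). lra. }
      apply Nat.le_trans with 1%nat; auto.
      apply (NoDup_incl_length (l' := Singleton C z :: nil) Hl).
      intros b Hb. left. destruct (Hml b Hb) as [HBb [x Hx]]. destruct Hx as [x Ax Hbx].
      apply only in Ax. subst x. destruct HBb as [HBb|(z' & Hz' & ->)].
      * exfalso. apply (HIZ z Iz). now apply (HB1 b).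
      * now destruct Hbx.
    + apply (HM A); auto.
      * intros x Ax. destruct (proj1 (HX x) (HA x Ax)); auto. exfalso. eauto.
      * intros b Hb. destruct (Hml b Hb) as [HBb M]. split; auto.
        destruct HBb as [HBb|(z' & Hz' & ->)]; auto. exfalso.
        destruct M as [x Hx]. destruct Hx as [x Ax Hx]. destruct Hx. eauto.
Qed.

(** Consequently two distinct points are at least half as far from each other as the more remote one
    is from [e]; the centre [e] may itself belong to [S]. *)
Definition lacunary_about (e : C) (S : Ensemble C) : Prop :=
  forall z w, S z -> S w -> z <> w ->
    2 * dist z e <= dist w e \/ 2 * dist w e <= dist z e.

(* At scale [s], points of [S] at distance more than [2 s] from [e] are isolated;
   the others are absorbed by thickening a cover of [Y] at scale [5 s]. *)
Lemma admissible_lacunary_union (Y S : Ensemble C) (e : C) (m : nat) :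
  Y e -> lacunary_about e S ->
  (forall z y, S z -> Y y -> y <> e -> 2 * dist z e <= dist y e) ->
  (1 <= m)%nat -> admissible Y m -> admissible (Union C Y S) m.
Proof.
  intros Ye HS HSY Hm (c & Hc & H). exists (c * 5 + 4). split; [lra|]. intros s Hs.
  destruct (H (s + 2 * (2 * s))) as (B & H1 & H2 & H3); [lra|].
  set (I := (fun z => S z /\ ~ Y z /\ 2 * s < dist z e) : Ensemble C).
  set (Z := (fun z => Union C Y S z /\ ~ I z) : Ensemble C).
  destruct (thicken_cover Z Y B s (2 * s) (c * (s + 2 * (2 * s))) m) as (B' & G1 & G2 & G3); auto.
  { intros x [Hx NI]. destruct (classic (Y x)) as [Yx|NY].
    - exists x. rewrite dist_diag. split; auto. lra.
    - exists e. split; auto. apply Rnot_lt_le. intros L. apply NI.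
      destruct Hx as [x Hx|x Hx]; [tauto|]. split; auto. }
  replace (c * (s + 2 * (2 * s)) + 2 * (2 * s)) with ((c * 5 + 4) * s) in G2 by ring.
  apply (add_isolated_points (Union C Y S) Z I B'); auto.
  - intros x. split.
    + intros Hx. destruct (classic (I x)); [tauto|]. left. split; auto.
    + intros [[Hx _]|[Hx _]]; auto. now right.
  - intros z Hz [_ N]. auto.
  - intros z x (Sz & NYz & Lz) Hx N.
    assert (T1 := dist_triangle z x e). assert (T2 := dist_triangle x z e).
    rewrite (dist_comm z x) in T1. destruct Hx as [x Hx|x Hx].
    + destruct (classic (x = e)) as [->|Ne]; [rewrite dist_comm; lra|].
      specialize (HSY z x Sz Hx Ne). lra.
    + destruct (HS x z Hx Sz N); lra.
  - nra.
Qed.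

Lemma admissible_lacunary (S : Ensemble C) (e : C) : lacunary_about e S -> admissible S 1.
Proof.
  intros HS. apply (admissible_closure S (Union C (Singleton C e) S)).
  - intros x Hx. apply closure_incl. now right.
  - apply (admissible_lacunary_union _ _ e); auto using admissible_singleton.
    + constructor.
    + intros z y _ Hy N. destruct Hy. tauto.
Qed.

(** * Countable dense subsets *)

Lemma nat_fraction_near (x : R) (k : nat) :
  exists a b : nat, Rabs (x - (INR a - INR b) / (INR k + 1)) <= 1 / (INR k + 1).
Proof.
  assert (P := pos_INR k). set (q := INR k + 1) in *. assert (0 < q) by (unfold q; lra).
  destruct (archimed (x * q)) as [U1 U2]. set (n := up (x * q)) in *.
  exists (Z.to_nat n), (Z.to_nat (- n)).
  replace (INR (Z.to_nat n) - INR (Z.to_nat (- n))) with (IZR n).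
  2:{ rewrite !INR_IZR_INZ, <- minus_IZR. f_equal. lia. }
  replace (x - IZR n / q) with ((x * q - IZR n) / q) by (field; lra).
  unfold Rdiv. rewrite Rabs_mult, (Rabs_pos_eq (/ q)) by (left; now apply Rinv_0_lt_compat).
  apply Rmult_le_compat_r; [left; now apply Rinv_0_lt_compat|]. apply Rabs_le. lra.
Qed.

(** Rational points may all miss [T], so a point of [T] is picked in each rational disc of radius
    [2 / (k + 1)] that meets [T], with [t0] as default for the others. A point and the pick from its
    disc are at most two radii apart. *)
Lemma dense_sequence (T : Ensemble C) :
  Inhabited C T -> exists y : nat -> C, (forall n, T (y n)) /\
    forall z e, T z -> 0 < e -> exists n, dist z (y n) < e.
Proof.
  intros [t0 Ht0].
  set (coord := fun (p k : nat) => let (a, b) := Cantor.of_nat p in (INR a - INR b) / (INR k + 1)).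
  set (P := fun n t => let (p, k) := Cantor.of_nat n in let (p1, p2) := Cantor.of_nat p in
     T t /\ dist t (coord p1 k, coord p2 k) <= 2 / (INR k + 1)).
  set (y := fun n => match excluded_middle_informative (exists t, P n t) with
    | left H => proj1_sig (constructive_indefinite_description _ H)
    | right _ => t0 end).
  exists y. split.
  - intros n. unfold y. destruct (excluded_middle_informative _) as [H|_]; auto.
    destruct (constructive_indefinite_description _ H) as [t Ht]. simpl.
    unfold P in Ht. destruct (Cantor.of_nat n) as [p k], (Cantor.of_nat p). tauto.
  - intros z e Tz He. destruct (INR_unbounded (4 / e)) as [k Hk].
    assert (Pk := pos_INR k).
    assert (Hk4 : 4 / (INR k + 1) < e).
    { apply Rlt_div_l; [lra|]. apply Rlt_div_l in Hk; auto. nra. }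
    destruct (nat_fraction_near (Re z) k) as (a1 & b1 & Q1).
    destruct (nat_fraction_near (Im z) k) as (a2 & b2 & Q2).
    set (n := Cantor.to_nat
      (Cantor.to_nat (Cantor.to_nat (a1, b1), Cantor.to_nat (a2, b2)), k)).
    set (ctr := ((INR a1 - INR b1) / (INR k + 1), (INR a2 - INR b2) / (INR k + 1)) : C).
    assert (EP : forall t, P n t <-> T t /\ dist t ctr <= 2 / (INR k + 1)).
    { intros t. unfold P, n, coord. rewrite !Cantor.cancel_of_to. reflexivity. }
    assert (Hz : dist z ctr <= 2 / (INR k + 1)).
    { unfold dist. eapply Rle_trans; [apply Cmod_le_Re_Im|].
      unfold Cminus. rewrite re_plus, im_plus, re_opp, im_opp.
      unfold Rminus in Q1, Q2. simpl.
      replace (2 / (INR k + 1)) with (1 / (INR k + 1) + 1 / (INR k + 1)) by (field; lra).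
      apply Rplus_le_compat; assumption. }
    exists n. unfold y. destruct (excluded_middle_informative _) as [H|N].
    + destruct (constructive_indefinite_description _ H) as [t Ht]. simpl.
      apply EP in Ht. destruct Ht as [_ Ht].
      generalize (dist_triangle z ctr t). rewrite (dist_comm ctr t).
      replace (4 / (INR k + 1)) with (2 / (INR k + 1) + 2 / (INR k + 1)) in Hk4 by (field; lra).
      lra.
    + exfalso. apply N. exists z. apply EP. auto.
Qed.

(** * The lacunary set *)

Lemma dist_0_r (z : C) : dist z 0 = Cmod z.
Proof. unfold dist. f_equal. ring. Qed.

(* Preimages are picked with rapidly increasing moduli, except over the at most
   one value with bounded fibre, whose preimage is chosen once and for all. *)
Lemma lacunary_selection (f : C -> C) (T : Ensemble C) :
  (forall a b, bounded_fibre f a -> bounded_fibre f b -> a = b) ->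
  Inhabited C T -> Included C T (image f (Full_set C)) ->
  exists X : Ensemble C, Inhabited C X /\ countable X /\ lacunary_about 0 X /\
    Included C (image f X) T /\ dense_in (image f X) T.
Proof.
  intros Hpic IT HT. destruct (dense_sequence T IT) as (y & HyT & Hyd).
  set (pre := fun v => epsilon (inhabits (RtoC 0)) (fun x => f x = v)).
  assert (Hpre : forall v, T v -> f (pre v) = v).
  { intros v Tv. unfold pre. apply epsilon_spec. destruct (HT v Tv) as [x _ v E]. eauto. }
  assert (Hex : exists e, forall v, bounded_fibre f v -> v = e).
  { destruct (classic (exists e, bounded_fibre f e)) as [[e He]|N].
    - exists e. auto.
    - exists 0. intros v Hv. exfalso. eauto. }
  destruct Hex as [e He].
  assert (Hg : forall (v : C) (b : R), exists x, T v -> f x = v /\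
     (bounded_fibre f v -> x = pre v) /\ (~ bounded_fibre f v -> b <= Cmod x)).
  { intros v b. destruct (classic (bounded_fibre f v)) as [Bv|Bv].
    - exists (pre v). intros Tv. repeat split; auto. tauto.
    - apply NNPP. intros N. apply Bv. exists b. intros z Hz. apply Rnot_lt_le. intros L.
      apply N. exists z. intros _. repeat split; [auto|tauto|lra]. }
  set (g := fun v b => proj1_sig (constructive_indefinite_description _ (Hg v b))).
  assert (Hgs : forall v b, T v -> f (g v b) = v /\
     (bounded_fibre f v -> g v b = pre v) /\ (~ bounded_fibre f v -> b <= Cmod (g v b))).
  { intros v b. unfold g. apply proj2_sig. }
  clearbody g.
  (* [bd n] dominates the moduli of all earlier points. It starts at the preimage of the possible
     exceptional value, so that every other point is at least twice as large, wherever that value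
     occurs in the sequence. If there is no exceptional value, [e] is arbitrary and the start
     harmless. *)
  set (bd := fix bd n := match n with
    | O => Cmod (pre e)
    | S n => Rmax (bd n) (Cmod (g (y n) (2 * bd n))) end).
  set (x := fun n => g (y n) (2 * bd n)).
  assert (bd_mono : forall m n, (m <= n)%nat -> bd m <= bd n).
  { intros m n L. induction L; [lra|]. eapply Rle_trans; [exact IHL|]. simpl. apply Rmax_l. }
  assert (x_bd : forall m n, (m < n)%nat -> Cmod (x m) <= bd n).
  { intros m n L. apply Rle_trans with (bd (S m)); [|apply bd_mono; lia].
    simpl. unfold x. apply Rmax_r. }
  assert (Hfx : forall n, f (x n) = y n) by (intros n; now apply Hgs).
  assert (lac : forall m n, (m < n)%nat -> x m <> x n ->
     2 * Cmod (x m) <= Cmod (x n) \/ 2 * Cmod (x n) <= Cmod (x m)).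
  { intros m n L N.
    destruct (Hgs (y m) (2 * bd m) (HyT m)) as (_ & M1 & M2).
    destruct (Hgs (y n) (2 * bd n) (HyT n)) as (_ & N1 & N2).
    fold (x m) in M1, M2. fold (x n) in N1, N2.
    destruct (classic (bounded_fibre f (y n))) as [Bn|Bn].
    - destruct (classic (bounded_fibre f (y m))) as [Bm|Bm].
      + exfalso. apply N. rewrite M1, N1 by auto. f_equal. now apply Hpic.
      + right. rewrite N1, (He (y n)) by auto.
        generalize (M2 Bm) (bd_mono O m ltac:(lia)). simpl. lra.
    - left. generalize (N2 Bn) (x_bd m n L). lra. }
  exists (fun z => exists n, z = x n). split; [|split; [|split; [|split]]].
  - exists (x O). now exists O.
  - exists (fun z => epsilon (inhabits O) (fun n => z = x n)).
    intros z w Hz Hw E. apply (epsilon_spec (inhabits O)) in Hz, Hw.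
    rewrite Hz, Hw. now rewrite E.
  - intros z w [m ->] [n ->] N. rewrite !dist_0_r.
    destruct (Nat.lt_total m n) as [L|[->|L]]; [auto|tauto|].
    destruct (lac n m L); auto.
  - intros v Hv. destruct Hv as [z [n ->] v ->]. rewrite Hfx. apply HyT.
  - intros v Tv eps Heps. destruct (Hyd v eps Tv Heps) as [n Hn]. exists (y n). split; auto.
    exists (x n); [now exists n|]. auto.
Qed.

(* When [Y] has an isolated omitted value [e], it is replaced in the target by
   the points [e + d / 2 ^ n]. *)
Lemma attained_target (f : C -> C) (Y : Ensemble C) :
  (forall a b, bounded_fibre f a -> bounded_fibre f b -> a = b) ->
  Inhabited C Y ->
  exists T : Ensemble C, Inhabited C T /\ Included C T (image f (Full_set C)) /\
    dense_in T Y /\ (forall m, (1 <= m)%nat -> admissible Y m -> admissible T m) /\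
    (dense_in (Intersection C Y (image f (Full_set C))) Y -> Included C T Y).
Proof.
  intros Hpic [y0 Hy0].
  destruct (classic (dense_in (Intersection C Y (image f (Full_set C))) Y)) as [D|ND].
  - assert (sub : Included C (Intersection C Y (image f (Full_set C))) Y)
      by (intros v Hv; now destruct Hv).
    exists (Intersection C Y (image f (Full_set C))).
    split; [|split; [|split; [|split]]]; auto.
    + destruct (D y0 Hy0 1 Rlt_0_1) as (w & Hw & _). now exists w.
    + intros v Hv. now destruct Hv.
    + intros m _. apply admissible_closure. intros v Hv. now apply closure_incl, sub.
  - assert (HN : exists e d, Y e /\ 0 < d /\
       forall w, Y w -> image f (Full_set C) w -> d <= dist e w).
    { apply NNPP. intros N. apply ND. intros e Ye d Hd. apply NNPP. intros N'.
      apply N. exists e, d. repeat split; auto. intros w Yw Iw. apply Rnot_lt_le. intros L.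
      apply N'. exists w. repeat split; auto. }
    destruct HN as (e & d & Ye & Hd & sep).
    assert (omit : forall z, f z <> e).
    { intros z E. assert (Q := sep e Ye). rewrite dist_diag in Q.
      enough (d <= 0) by lra. apply Q. exists z; [constructor|auto]. }
    (* A second omitted value would also have a bounded fibre and so coincide with [e]. *)
    assert (attained : forall v, v <> e -> image f (Full_set C) v).
    { intros v N. apply NNPP. intros NI. apply N. apply Hpic.
      - exists 0. intros z E. exfalso. apply NI. exists z; [constructor|auto].
      - exists 0. intros z E. exfalso. exact (omit z E). }
    (* Starting at [d / 2] makes twice the distance of each new point from [e] at most [d]. All
       other points of [Y] are attained values and so at distance at least [d], the separation that
       the union lemma demands. *)
    set (pt := fun n => (e + RtoC (d / 2 * (/2)^n))%C).
    assert (half : forall n, 0 < (/2)^n) by (intros n; apply pow_lt; lra).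
    assert (dpt : forall n, dist (pt n) e = d / 2 * (/2)^n).
    { intros n. unfold dist, pt.
      replace (e + RtoC (d / 2 * (/2)^n) - e)%C with (RtoC (d / 2 * (/2)^n)) by ring.
      rewrite Cmod_R, Rabs_pos_eq; auto. specialize (half n). nra. }
    assert (dpt_pos : forall n, 0 < dist (pt n) e)
      by (intros n; rewrite dpt; specialize (half n); nra).
    set (S := (fun z => exists n, z = pt n) : Ensemble C).
    assert (halving : forall i j, (i < j)%nat -> 2 * dist (pt j) e <= dist (pt i) e).
    { intros i j L. rewrite !dpt. replace j with (i + 1 + (j - i - 1))%nat by lia.
      rewrite !pow_add. assert (Pi := half i).
      assert ((/2)^(j - i - 1) <= 1).
      { rewrite <- (pow1 (j - i - 1)). apply pow_incr. lra. }
      assert (Pj := half (j - i - 1)%nat). set (u := (/2)^i) in *.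
      set (v := (/2)^(j - i - 1)) in *. simpl.
      assert (u * v <= u) by nra. nra. }
    set (T := (fun v => (Y v \/ S v) /\ v <> e) : Ensemble C).
    assert (S_T : forall n, T (pt n)).
    { intros n. split; [right; now exists n|]. intros E. specialize (dpt_pos n).
      rewrite E, dist_diag in dpt_pos. lra. }
    exists T. split; [|split; [|split; [|split]]].
    + exists (pt O). apply S_T.
    + intros v [_ N]. now apply attained.
    + intros v Yv eps Heps. destruct (Ceq_dec v e) as [->|N].
      * destruct (pow_lt_1_zero (/2) ltac:(rewrite Rabs_pos_eq; lra) (eps / d)) as [n Hn].
        { now apply Rdiv_lt_0_compat. }
        exists (pt n). split; auto. rewrite dist_comm, dpt.
        specialize (Hn n ltac:(lia)). assert (P := half n).
        rewrite Rabs_pos_eq in Hn by lra. apply Rlt_div_r in Hn; auto. nra.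
      * exists v. split; [split; auto|]. now rewrite dist_diag.
    + intros m Hm A. apply (admissible_closure T (Union C Y S)).
      { intros v [[Yv|Sv] _]; apply closure_incl; [now left|now right]. }
      apply (admissible_lacunary_union Y S e); auto.
      * intros z w [i ->] [j ->] N.
        destruct (Nat.lt_total i j) as [L|[->|L]]; [right; auto|tauto|left; auto].
      * intros z y [n ->] Yy Ny. rewrite (dist_comm y e).
        apply Rle_trans with d; [|now apply sep; auto].
        rewrite dpt. assert ((/2)^n <= 1) by (rewrite <- (pow1 n); apply pow_incr; lra).
        nra.
    + intros D. contradiction.
Qed.

(* If [f] omits an isolated point of [Y] (e.g. [f = exp], [Y = {0}]), or if [Y]
   is empty, no admissible [X] has [f(X)] inside [Y]; the last clause asserts
   the inclusion in every other case. *)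
Theorem theorem1p2 :
  forall f : C -> C,
    entire f ->
    ~ (exists c : C, forall z : C, f z = c) ->
    essential_singularity_at_infinity f ->
    forall Y : Ensemble C,
    exists X : Ensemble C,
      countable X /\
      nagata_dim X = Finite 0 /\
      dense_in (image f X) Y /\
      (Inhabited C Y -> nagata_dim (image f X) = nagata_dim Y) /\
      (Inhabited C Y ->
       dense_in (Intersection C Y (image f (Full_set C))) Y ->
       Included C (image f X) Y).
Proof.
  intros f Hf Nc [_ [_ NP]] Y.
  assert (Df : forall z, exists k, cderiv f z k).
  { intros z. apply ex_derive_cderiv, Hf. constructor. }
  assert (Hpic : forall a b, bounded_fibre f a -> bounded_fibre f b -> a = b).
  { intros a b. apply picard; auto. now apply not_pole_at_infinity. }
  destruct (classic (Inhabited C Y)) as [IY|NY].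
  - destruct (attained_target f Y Hpic IY) as (T & IT & HT & DT & AT & TY).
    destruct (lacunary_selection f T Hpic IT HT) as (X & IX & CX & LX & XT & DX).
    assert (DY : dense_in (image f X) Y).
    { intros v Yv eps Heps. destruct (DT v Yv (eps / 2)) as (w & Tw & L1); [lra|].
      destruct (DX w Tw (eps / 2)) as (u & Xu & L2); [lra|].
      exists u. split; auto. generalize (dist_triangle v w u). lra. }
    assert (IfX : Inhabited C (image f X)).
    { destruct IX as [x Hx]. exists (f x). now exists x. }
    exists X. split; [auto|split; [|split; [auto|split]]].
    + apply nagata_dim_0; auto. now apply (admissible_lacunary X 0).
    (* As [f(X)] may leave [Y], one inequality passes through [T]; the other holds because [Y] lies
       in the closure of [f(X)]. *)
    + intros _. apply Rbar_le_antisym; apply nagata_dim_le; auto.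
      * intros m Hm A. apply (admissible_closure (image f X) T); auto.
        intros v Hv. now apply closure_incl, XT.
      * intros m _. now apply admissible_closure.
    + intros _ D v Hv. now apply TY, XT.
  (* For empty [Y] a point is taken, since the empty set would have dimension -1 instead of 0. *)
  - exists (Singleton C 0). split; [|split; [|split; [|split]]]; try tauto.
    + exists (fun _ => O). intros z w Hz Hw _. now destruct Hz, Hw.
    + apply nagata_dim_0; [exists (RtoC 0); constructor|apply admissible_singleton].
    + intros v Yv. exfalso. apply NY. now exists v.
Qed.
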